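(* Let $n\ge 3$. Suppose that $P \in \mathrm{LO}(B_n)$ and $\Delta_n^2 \in P$, and that $\Delta_{n-1}^2$ is not cofinal in the left ordering of $B_n$ determined by $P$. Then $\tau_{\beta}(P) = \tau_{\beta}(P_D)$ for all $\beta \in B_n$.
   Context: $B_n$ is the braid group with Artin generators $\sigma_1,\dots,\sigma_{n-1}$ (relations $\sigma_i\sigma_j=\sigma_j\sigma_i$ for $|i-j|>1$ and $\sigma_i\sigma_j\sigma_i=\sigma_j\sigma_i\sigma_j$ for $|i-j|=1$). For $1<m<n$, $B_m$ is identified with the subgroup of $B_n$ generated by $\sigma_1,\dots,\sigma_{m-1}$. Put $\delta_k=\sigma_1\sigma_2\cdots\sigma_{k-1}$ and $\Delta_m=\delta_m\delta_{m-1}\cdots\delta_2$ (Garside element of $B_m$); via $B_{n-1}\subset B_n$, $\Delta_{n-1}^2$ is an element of $B_n$. A positive cone of a group $G$ is a subset $P\subset G$ with $P\cdot P\subset P$, $G\setminus\{id\}=P\cup P^{-1}$ and $P\cap P^{-1}=\emptyset$; it determines a left ordering by $g<h \iff g^{-1}h\in P$. $\mathrm{LO}(G)$ is the set of positive cones of $G$. An element $g$ is cofinal in a left ordering $<$ of $G$ if $G=\{h\in G\mid \exists k\in\mathbb{Z},\ g^{-k}<h<g^k\}$. It is known that $\Delta_n^2$ is central in $B_n$ and cofinal in every left ordering of $B_n$. For $P\in \mathrm{LO}(B_n)$ with $\Delta_n^2\in P$, with associated ordering $<$, the floor $[\beta]_P$ of $\beta\in B_n$ is the unique integer with $\Delta_n^{2[\beta]_P}\le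 \beta<\Delta_n^{2([\beta]_P+1)}$, and the translation number is $\tau_\beta(P)=\lim_{k\to\infty}[\beta^k]_P/k$. $P_D\in\mathrm{LO}(B_n)$ is the positive cone of the Dehornoy ordering: the set of braids that are $i$-positive for some $1\le i\le n-1$, where a braid is $i$-positive if it is represented by a word in the generators in which $\sigma_i$ occurs, only with positive exponents, and no $\sigma_j^{\pm1}$ with $j>i$ occurs. (It is known that this is a positive cone; it contains $\Delta_n^2$.) *)

(* Defs.v *)
From HB Require Import structures.
From mathcomp Require Import all_boot all_order all_algebra.
From mathcomp Require Import all_classical all_reals all_analysis.

Set Implicit Arguments.
Unset Strict Implicit.
Unset Printing Implicit Defensive.

Import Order.TTheory GRing.Theory Num.Theory.
Import numFieldNormedType.Exports.

Local Open Scope classical_set_scope.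
Local Open Scope quotient_scope.
Local Open Scope group_scope.

(** The braid group, as the group presented by the Artin generators. *)

(* Ordinals count from 0: the letter (i, true) stands for sigma_(i+1) and
   (i, false) for its inverse. *)
Definition braid_word (n : nat) := seq ('I_n.-1 * bool).

Inductive braid_eqv (n : nat) : braid_word n -> braid_word n -> Prop :=
| braid_eqv_refl w : braid_eqv w w
| braid_eqv_sym v w : braid_eqv v w -> braid_eqv w v
| braid_eqv_trans u v w : braid_eqv u v -> braid_eqv v w -> braid_eqv u w
| braid_eqv_cat v v' w w' :
    braid_eqv v v' -> braid_eqv w w' -> braid_eqv (v ++ w) (v' ++ w')
| braid_eqv_cancel i b : braid_eqv [:: (i, b); (i, ~~ b)] [::]
| braid_eqv_comm (i j : 'I_n.-1) : (i.+1 < j)%N ->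
    braid_eqv [:: (i, true); (j, true)] [:: (j, true); (i, true)]
| braid_eqv_braid (i j : 'I_n.-1) : i.+1 = j :> nat ->
    braid_eqv [:: (i, true); (j, true); (i, true)]
              [:: (j, true); (i, true); (j, true)].

Definition braid_rel (n : nat) : rel (braid_word n) :=
  fun v w => `[< braid_eqv v w >].

Lemma braid_rel_refl n : reflexive (@braid_rel n).
Proof. by move=> w; apply/asboolP/braid_eqv_refl. Qed.

Lemma braid_rel_sym n : symmetric (@braid_rel n).
Proof.
by move=> v w; apply/asboolP/asboolP; apply: braid_eqv_sym.
Qed.

Lemma braid_rel_trans n : transitive (@braid_rel n).
Proof.
move=> v u w /asboolP uv /asboolP vw; apply/asboolP.
exact: braid_eqv_trans uv vw.
Qed.

Canonical braid_equiv (n : nat) :=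
  EquivRel (@braid_rel n) (@braid_rel_refl n) (@braid_rel_sym n)
    (@braid_rel_trans n).

Definition braid (n : nat) : Type := {eq_quot (@braid_rel n)}.

HB.instance Definition _ n := EqQuotient.on (braid n).
HB.instance Definition _ n := Choice.on (braid n).

Definition braid_of (n : nat) (w : braid_word n) : braid n := \pi_(braid n) w.

Lemma braid_ofP n (v w : braid_word n) :
  braid_of v = braid_of w <-> braid_eqv v w.
Proof.
split; first by move=> /eqquotP/asboolP.
by move=> vw; apply/eqquotP/asboolP.
Qed.

Lemma braid_of_repr n (x : braid n) : braid_of (repr x) = x.
Proof. exact: reprK. Qed.

Definition word_inv (n : nat) (w : braid_word n) : braid_word n :=
  rev [seq (l.1, ~~ l.2) | l <- w].

Lemma word_invK n : involutive (@word_inv n).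
Proof.
move=> w; rewrite /word_inv map_rev revK -map_comp -[RHS]map_id.
by apply: eq_map => -[i b] /=; rewrite negbK.
Qed.

Lemma word_inv_cat n (v w : braid_word n) :
  word_inv (v ++ w) = word_inv w ++ word_inv v.
Proof. by rewrite /word_inv map_cat rev_cat. Qed.

Lemma word_invr n (w : braid_word n) : braid_eqv (w ++ word_inv w) [::].
Proof.
elim: w => [|[i b] w IH]; first exact: braid_eqv_refl.
rewrite -cat1s word_inv_cat -catA (catA w).
apply: (braid_eqv_trans (v := [:: (i, b)] ++ ([::] ++ word_inv [:: (i, b)]))).
  apply: braid_eqv_cat; first exact: braid_eqv_refl.
  by apply: braid_eqv_cat => //; exact: braid_eqv_refl.
exact: braid_eqv_cancel.
Qed.

Lemma word_invl n (w : braid_word n) : braid_eqv (word_inv w ++ w) [::].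
Proof. by rewrite -{2}[w]word_invK; exact: word_invr. Qed.

Lemma word_inv_eqv n (v w : braid_word n) :
  braid_eqv v w -> braid_eqv (word_inv v) (word_inv w).
Proof.
move=> vw; apply: (braid_eqv_trans (v := word_inv v ++ (w ++ word_inv w))).
  rewrite -{1}[word_inv v]cats0; apply: braid_eqv_cat.
    exact: braid_eqv_refl.
  exact/braid_eqv_sym/word_invr.
rewrite catA -{2}[word_inv w]cat0s.
apply: braid_eqv_cat; last exact: braid_eqv_refl.
apply: braid_eqv_trans (word_invl v).
by apply: braid_eqv_cat; [exact: braid_eqv_refl | exact: braid_eqv_sym].
Qed.

Definition braid_one (n : nat) : braid n := braid_of [::].
Definition braid_mul (n : nat) (x y : braid n) : braid n :=
  braid_of (repr x ++ repr y).
Definition braid_inv (n : nat) (x : braid n) : braid n :=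
  braid_of (word_inv (repr x)).

Lemma repr_braid_of n (w : braid_word n) : braid_eqv (repr (braid_of w)) w.
Proof. by apply/braid_ofP; rewrite braid_of_repr. Qed.

Lemma braid_of_mul n (v w : braid_word n) :
  braid_mul (braid_of v) (braid_of w) = braid_of (v ++ w).
Proof. by apply/braid_ofP/braid_eqv_cat; exact: repr_braid_of. Qed.

Lemma braid_of_inv n (w : braid_word n) :
  braid_inv (braid_of w) = braid_of (word_inv w).
Proof. by apply/braid_ofP/word_inv_eqv/repr_braid_of. Qed.

Lemma braid_mulA n : associative (@braid_mul n).
Proof.
move=> x y z.
rewrite -(braid_of_repr x) -(braid_of_repr y) -(braid_of_repr z).
by rewrite !braid_of_mul catA.
Qed.

Lemma braid_mul1 n : left_id (@braid_one n) (@braid_mul n).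
Proof. by move=> x; rewrite -(braid_of_repr x) braid_of_mul. Qed.

Lemma braid_mulr1 n : right_id (@braid_one n) (@braid_mul n).
Proof. by move=> x; rewrite -(braid_of_repr x) braid_of_mul cats0. Qed.

Lemma braid_mulV n : left_inverse (@braid_one n) (@braid_inv n) (@braid_mul n).
Proof.
move=> x; rewrite -(braid_of_repr x) braid_of_inv braid_of_mul.
exact/braid_ofP/word_invl.
Qed.

Lemma braid_mulrV n :
  right_inverse (@braid_one n) (@braid_inv n) (@braid_mul n).
Proof.
move=> x; rewrite -(braid_of_repr x) braid_of_inv braid_of_mul.
exact/braid_ofP/word_invr.
Qed.

HB.instance Definition _ n :=
  isGroup.Build (braid n) (@braid_mulA n) (@braid_mul1 n) (@braid_mulr1 n)
    (@braid_mulV n) (@braid_mulrV n).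

(* sigma i is the generator sigma_(i+1). *)
Definition sigma (n : nat) (i : 'I_n.-1) : braid n := braid_of [:: (i, true)].

(* delta_k = sigma_1 ... sigma_(k-1), as an element of B_n (k <= n). *)
Definition delta (n k : nat) : braid n := \prod_(i < n.-1 | i.+1 < k) sigma i.

(* Delta_m = delta_m delta_(m-1) ... delta_2, as an element of B_n (m <= n). *)
Definition Delta (n m : nat) : braid n :=
  \prod_(k <- rev (iota 2 m.-1)) delta n k.

(** Left orderings *)

Definition expgz (G : groupType) (g : G) (k : int) : G :=
  match k with Posz m => g ^+ m | Negz m => g ^- m.+1 end.

Definition LO (G : groupType) : set (set G) :=
  [set P | [/\ forall g h, P g -> P h -> P (g * h),
               ~` [set 1] = P `|` [set g^-1 | g in P]
             & P `&` [set g^-1 | g in P] = set0]].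

Arguments LO G : clear implicits.

Definition lt_cone (G : groupType) (P : set G) (g h : G) : Prop :=
  P (g^-1 * h).

Definition le_cone (G : groupType) (P : set G) (g h : G) : Prop :=
  g = h \/ lt_cone P g h.

Definition cofinal (G : groupType) (P : set G) (g : G) : Prop :=
  [set: G] = [set h | exists k : int,
    lt_cone P (expgz g (- k)%R) h /\ lt_cone P h (expgz g k)].

(** Floor and translation number *)

(* The value 0 is used only when no such integer exists, which does not happen
   for P in LO (B_n) containing Delta_n^2. *)
Definition braid_floor (n : nat) (P : set (braid n)) (b : braid n) : int :=
  xget 0%R [set k : int | le_cone P (expgz (Delta n n ^+ 2) k) b /\
                          lt_cone P b (expgz (Delta n n ^+ 2) (k + 1)%R)].

Definition translation_number (R : realType) (n : nat) (P : set (braid n))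
    (b : braid n) : R :=
  limn (fun k : nat => (braid_floor P (b ^+ k)%g)%:~R / k%:R : R)%R.

(** The Dehornoy ordering *)

Definition i_positive (n : nat) (i : 'I_n.-1) (b : braid n) : Prop :=
  exists w : braid_word n,
    [/\ b = braid_of w, (i, true) \in w, (i, false) \notin w
      & forall (j : 'I_n.-1) (e : bool), (j, e) \in w -> (j <= i)%N].

Definition dehornoy_cone (n : nat) : set (braid n) :=
  [set b | exists i : 'I_n.-1, i_positive i b].

Arguments dehornoy_cone n : clear implicits.

(* Main.v *)
Require Import Defs.
From Stdlib Require Setoid Morphisms.
From Stdlib Require Import Relations.
From mathcomp Require Import all_boot all_order all_algebra.
From mathcomp Require Import all_classical all_reals all_analysis.
From mathcomp Require Import zify.
Import numFieldNormedType.Exports.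

(** Put z = Delta_n^2.  The powers of Delta_(n-1)^2, hence (being cofinal in
    it) all of B_(n-1), lie below some z^N, so the cut
    C = {g | g <= b for some b in B_(n-1)} is bounded, fixed by B_(n-1) and
    moved by z.  The cuts g C are linearly ordered by inclusion, and
    sigma_(n-1) C contains C strictly, since otherwise z C would be contained
    in C.  Hence C is contained in b C for every Dehornoy positive b, and the
    two floors of a braid differ by at most N + 1; applied to the powers of
    beta this gives the same translation number.

    The Dehornoy floor exists because every braid is trivial, positive or
    negative.  To see this, write the braid as x^-1 y with x and y left
    divisors of a positive braid c, and work in the finite graph of left
    divisors of c.  At level k, letters below k may be followed in both
    directions and the letter k only forward.  This is acyclic up to moves by
    letters below k: an (n-1)-positive braid moves C, and conjugation by
    delta_n raises indices.  If x and x' are joined by a path of level k-1,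
    then least common multiples make x sigma_k and x' sigma_k joined by a path
    of level k (a handle reduction), so Noetherian induction shows that any two
    divisors connected by letters up to k are comparable at level k. *)

Set Implicit Arguments.
Unset Strict Implicit.
Unset Printing Implicit Defensive.

(** * Positive braid words *)

(* sigma_(i+1) is the letter i, for every natural number i. *)
Definition far (i j : nat) : bool := (i.+1 < j) || (j.+1 < i).
Definition adj (i j : nat) : bool := (i.+1 == j) || (j.+1 == i).

Inductive pstep : seq nat -> seq nat -> Prop :=
| pstep_far i j w : far i j -> pstep [:: i, j & w] [:: j, i & w]
| pstep_adj i j w : adj i j -> pstep [:: i, j, i & w] [:: j, i, j & w]
| pstep_cons i u v : pstep u v -> pstep (i :: u) (i :: v).

(** Equality in the positive braid monoid, as a chain of single relations extended at its end:
    [lcm_letters] inducts on the last step of such a chain. *)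
Inductive peq (u : seq nat) : seq nat -> Prop :=
| peq_refl : peq u u
| peq_step v w : peq u v -> pstep v w -> peq u w.

#[local] Hint Resolve peq_refl : core.

Lemma farC i j : far i j = far j i. Proof. exact: orbC. Qed.
Lemma adjC i j : adj i j = adj j i. Proof. exact: orbC. Qed.

Lemma pstep_sym u v : pstep u v -> pstep v u.
Proof.
elim=> {u v} [i j w|i j w|i u v _]; last exact: pstep_cons.
  by rewrite farC; exact: pstep_far.
by rewrite adjC; exact: pstep_adj.
Qed.

Lemma peq_trans u v w : peq u v -> peq v w -> peq u w.
Proof. by move=> uv; elim=> // v' w' _ uv' vw; exact: peq_step uv' vw. Qed.

Lemma peq1 u v : pstep u v -> peq u v.
Proof. exact/peq_step/peq_refl. Qed.

Lemma peq_sym u v : peq u v -> peq v u.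
Proof.
elim=> [|v' w _ vu vw]; first by [].
by apply: peq_trans vu; exact/peq1/pstep_sym.
Qed.

#[local] Instance peq_equivalence : RelationClasses.Equivalence peq.
Proof. by split; [exact: peq_refl | exact: peq_sym | exact: peq_trans]. Qed.

Lemma pstep_size u v : pstep u v -> size u = size v.
Proof. by elim=> //= i u' v' _ ->. Qed.

Lemma peq_size u v : peq u v -> size u = size v.
Proof. by elim=> // v' w _ -> /pstep_size. Qed.

Lemma pstep_all (p : pred nat) u v : pstep u v -> all p u -> all p v.
Proof.
elim=> /= [i j w _|i j w _|i u' v' _ IH].
- by rewrite andbCA.
- by move=> /and4P[-> -> _ ->].
- by move=> /andP[-> /IH].
Qed.

Lemma peq_all (p : pred nat) u v : peq u v -> all p u -> all p v.
Proof. by elim=> // v' w _ IH /pstep_all s /IH/s. Qed.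

#[local] Instance cons_peq :
  Morphisms.Proper (Morphisms.respectful eq (Morphisms.respectful peq peq))
    (@cons nat).
Proof.
move=> i _ <- u v; elim=> [|v' w _ IH s]; first by [].
by apply: peq_step IH _; exact: pstep_cons.
Qed.

Lemma pstep_catr u v w : pstep u v -> pstep (u ++ w) (v ++ w).
Proof.
elim=> /= [i j w' f|i j w' f|i u' v' _ s];
  [exact: pstep_far|exact: pstep_adj|exact: pstep_cons].
Qed.

#[local] Instance cat_peq :
  Morphisms.Proper (Morphisms.respectful peq (Morphisms.respectful peq peq))
    (@cat nat).
Proof.
move=> u u' uu v v' vv.
apply: (@peq_trans _ (u ++ v')).
  by elim: u {uu} => //= i u IH; rewrite IH.
elim: uu => [|x y _ IH s]; first by [].
by apply: peq_step IH _; exact: pstep_catr.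
Qed.

#[local] Instance rcons_peq :
  Morphisms.Proper (Morphisms.respectful peq (Morphisms.respectful eq peq))
    (@rcons nat).
Proof. by move=> u u' uu i _ <-; rewrite -!cats1 uu. Qed.

Lemma peq_far i j w : far i j -> peq [:: i, j & w] [:: j, i & w].
Proof. by move=> f; exact/peq1/pstep_far. Qed.

Lemma peq_adj i j w : adj i j -> peq [:: i, j, i & w] [:: j, i, j & w].
Proof. by move=> f; exact/peq1/pstep_adj. Qed.

Lemma pstep_rev u v : pstep u v -> peq (rev u) (rev v).
Proof.
elim=> [i j w f|i j w f|i u' v' _ IH]; last by rewrite !rev_cons IH.
- rewrite !rev_cons -!cats1 -!catA; apply: cat_peq => //=.
  by apply: peq_far; rewrite farC.
- by rewrite !rev_cons -!cats1 -!catA; apply: cat_peq => //=; exact: peq_adj.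
Qed.

Lemma peq_rev u v : peq u v -> peq (rev u) (rev v).
Proof.
by elim=> [|v' w _ IH /pstep_rev]; [exact: peq_refl | exact: peq_trans].
Qed.

(* i :: compl i j is the least common multiple of i and j. *)
Definition compl (i j : nat) : seq nat :=
  if i == j then [::] else if far i j then [:: j] else [:: j; i].

Lemma compl_eq i : compl i i = [::]. Proof. by rewrite /compl eqxx. Qed.

Lemma compl_far i j : far i j -> compl i j = [:: j].
Proof.
by rewrite /compl => f; rewrite f; case: eqP f => // ->; rewrite /far; lia.
Qed.

Lemma compl_adj i j : adj i j -> compl i j = [:: j; i].
Proof.
rewrite /compl => f; case: eqP f => [->|_]; first by rewrite /adj; lia.
by rewrite /adj => f; rewrite ifN //; rewrite /far; lia.
Qed.

Variant letter_spec (i j : nat) : Prop :=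
| Letter_eq of i = j
| Letter_far of far i j
| Letter_adj of adj i j.

Lemma letterP i j : letter_spec i j.
Proof.
case: (eqVneq i j) => [e|ne]; first exact: Letter_eq.
case f: (far i j); first exact: Letter_far.
by apply: Letter_adj; move: ne f; rewrite /adj /far; lia.
Qed.

(** * Garside's lemma: least common multiples and cancellation *)

Definition lcm_at (m : nat) := forall i j X Y, size X = m ->
  peq (i :: X) (j :: Y) ->
  exists Z, peq X (compl i j ++ Z) /\ peq Y (compl j i ++ Z).

Lemma cancel_at m i X Y : lcm_at m -> size X = m ->
  peq (i :: X) (i :: Y) -> peq X Y.
Proof. by move=> L sX /(L _ _ _ _ sX)[Z]; rewrite compl_eq => -[-> ->]. Qed.

Lemma lcm_far m i j X Y : lcm_at m -> size X = m -> far i j ->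
  peq (i :: X) (j :: Y) -> exists Z, peq X (j :: Z) /\ peq Y (i :: Z).
Proof.
move=> L sX f /(L _ _ _ _ sX)[Z].
by rewrite !compl_far // 1?farC // => -[? ?]; exists Z.
Qed.

Lemma lcm_adj m i j X Y : lcm_at m -> size X = m -> adj i j ->
  peq (i :: X) (j :: Y) -> exists Z, peq X [:: j, i & Z] /\ peq Y [:: i, j & Z].
Proof.
move=> L sX f /(L _ _ _ _ sX)[Z].
by rewrite !compl_adj // 1?adjC // => -[? ?]; exists Z.
Qed.

(** The case of [lcm_cube] in which the middle letter [k] is adjacent to [i] and far from [j];
    exchanging [i] and [j] covers the mirror case. Only tails shorter than [m] are compared. *)
Lemma cube_adj_far m i j k X Y W Z V : (forall m', m' < m -> lcm_at m') ->
  size X = m -> size Y = m -> adj k i -> far k j ->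
  peq X [:: k, i & Z] -> peq W [:: i, k & Z] ->
  peq W (j :: V) -> peq Y (k :: V) ->
  exists T, peq X (compl i j ++ T) /\ peq Y (compl j i ++ T).
Proof.
move=> L sX sY aki fkj XZ WZ WV YV.
have sZ : (size Z).+2 = m by rewrite -sX (peq_size XZ).
have e1 : peq (i :: k :: Z) (j :: V) by rewrite -WZ.
have fjk : far j k by rewrite farC.
have aik : adj i k by rewrite adjC.
have s1 : size (k :: Z) < m by rewrite -sZ.
case: (letterP i j) => [eij|fij|aij].
- by move: aki fkj; rewrite eij /adj /far; lia.
- have fji : far j i by rewrite farC.
  have [U [kZ VU]] := lcm_far (L _ s1) erefl fij e1.
  have s2 : size Z < m by lia.
  have [T [ZT UT]] := lcm_far (L _ s2) erefl fkj kZ.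
  exists [:: k, i & T]; rewrite compl_far // compl_far //=; split.
    by rewrite XZ ZT (peq_far _ fij) (peq_far _ fkj).
  by rewrite YV VU UT (peq_adj _ aki).
- have aji : adj j i by rewrite adjC.
  have [U [kZ VU]] := lcm_adj (L _ s1) erefl aij e1.
  have s2 : size Z < m by lia.
  have [T [ZT iUT]] := lcm_far (L _ s2) erefl fkj kZ.
  have sU : size U < m.
    by have := peq_size kZ; rewrite /=; lia.
  have [S [US TS]] := lcm_adj (L _ sU) erefl aik iUT.
  exists [:: k, i, j & S]; rewrite compl_adj // compl_adj //=; split.
    rewrite XZ ZT TS (peq_adj _ aij) (peq_far _ fkj) (peq_far S fjk).
    by rewrite (peq_adj _ aki).
  rewrite YV VU US (peq_far _ fjk) (peq_adj _ aki) (peq_adj _ aij).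
  by rewrite (peq_far _ fkj).
Qed.

(* The induction step of Garside's lemma along a chain i X ~ k W ~ j Y whose
   last step is a relation at the head. *)
Lemma lcm_cube m i j k X Y W Z V : (forall m', m' < m -> lcm_at m') ->
  size X = m -> size W = m -> size Y = m ->
  peq X (compl i k ++ Z) -> peq W (compl k i ++ Z) ->
  peq W (compl k j ++ V) -> peq Y (compl j k ++ V) ->
  exists T, peq X (compl i j ++ T) /\ peq Y (compl j i ++ T).
Proof.
move=> L sX sW sY.
case: (letterP i k) => [->|fik|aik].
- rewrite compl_eq /= => XZ WZ WV YV; exists V; split=> //.
  by rewrite XZ -WZ WV.
- case: (letterP k j) => [<-|fkj|akj].
  + rewrite (compl_eq k) /= => XZ WZ WV YV; exists Z; split=> //.
    by rewrite YV -WV WZ.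
  + rewrite compl_far // compl_far 1?farC // compl_far // compl_far 1?farC //=.
    move=> XZ WZ WV YV.
    have sZ : size Z < m by rewrite -sX (peq_size XZ).
    have /(L _ sZ _ _ _ _ erefl)[T [ZT VT]] : peq (i :: Z) (j :: V).
      by rewrite -WZ.
    have kcompl a b U : far a k -> far b k ->
        peq (k :: compl a b ++ U) (compl a b ++ k :: U).
      rewrite /compl => fa fb.
      case: ifP => [_|_]; first by [].
      have fka : far k a by rewrite farC.
      have fkb : far k b by rewrite farC.
      by case: ifP => [_|_] /=; rewrite (peq_far _ fkb) ?(peq_far _ fka).
    exists (k :: T); split.
      by rewrite XZ ZT kcompl // farC.
    by rewrite YV VT kcompl // farC.
  + rewrite compl_far // compl_far 1?farC // compl_adj // compl_adj 1?adjC //=.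
    move=> XZ WZ WV YV.
    have [|T [? ?]] := cube_adj_far (j := i) L sY sX akj _ YV WV WZ XZ.
      by rewrite farC.
    by exists T.
- case: (letterP k j) => [<-|fkj|akj].
  + rewrite (compl_eq k) /= => XZ WZ WV YV; exists Z; split=> //.
    by rewrite YV -WV WZ.
  + rewrite compl_adj // compl_adj 1?adjC // compl_far // compl_far 1?farC //=.
    move=> XZ WZ WV YV; apply: (cube_adj_far L sX sY _ fkj XZ WZ WV YV).
    by rewrite adjC.
  + rewrite compl_adj // compl_adj 1?adjC // compl_adj // compl_adj 1?adjC //=.
    move=> XZ WZ WV YV.
    (* Two neighbours of [k] are equal or differ by two, so [i] and [j] cannot be adjacent. *)
    have naij : ~~ adj i j by move: aik akj; rewrite /adj; lia.
    case: (letterP i j) => [eij|fij|]; last by rewrite (negPf naij).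
      subst j; exists X; rewrite compl_eq /=; split=> //.
      have e1 : peq (i :: k :: Z) (i :: k :: V) by rewrite -WZ.
      have sZ : (size Z).+2 = m by rewrite -sX (peq_size XZ).
      have e2 := cancel_at (L _ _) erefl e1.
      rewrite XZ YV (cancel_at (L _ _) erefl (e2 _)) //=; lia.
    have e1 : peq (i :: k :: Z) (j :: k :: V) by rewrite -WZ.
    have sZ : (size Z).+2 = m by rewrite -sX (peq_size XZ).
    have sV : (size V).+2 = m by rewrite -sY (peq_size YV).
    have s1 : size (k :: Z) < m by rewrite -sZ.
    have s2 : size Z < m by lia.
    have s3 : size V < m by lia.
    have aki : adj k i by rewrite adjC.
    have ajk : adj j k by rewrite adjC.
    have fji : far j i by rewrite farC.
    have [U [kZ kV]] := lcm_far (L _ s1) erefl fij e1.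
    have [S [ZS US]] := lcm_adj (L _ s2) erefl akj kZ.
    have [S' [VS' US']] := lcm_adj (L _ s3) erefl aki kV.
    have sS : size (j :: S) < m by have := peq_size ZS; rewrite /=; lia.
    have e2 : peq (k :: j :: S) (k :: i :: S') by rewrite -US.
    have e3 := cancel_at (L _ sS) erefl e2.
    have sS1 : size S < m by move: sS; rewrite /=; lia.
    have [T [ST S'T]] := lcm_far (L _ sS1) erefl fji e3.
    exists [:: k, i, j, k & T]; rewrite compl_far // compl_far //=; split.
      rewrite XZ ZS ST (peq_far _ fij) (peq_adj _ aik) (peq_adj _ akj).
      by rewrite (peq_far _ fji).
    by rewrite YV VS' S'T (peq_far _ fji) (peq_adj _ ajk) (peq_adj _ aki).
Qed.

Lemma pstep_consP k j W Y : pstep (k :: W) (j :: Y) ->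
  (k = j /\ pstep W Y) \/
  exists V, W = compl k j ++ V /\ Y = compl j k ++ V.
Proof.
move eA: (k :: W) => A; move eB: (j :: Y) => B s.
case: s eA eB => [a b w f|a b w f|a u v s] [-> ->] [-> ->]; last by left.
- by right; exists w; rewrite !compl_far // farC.
- by right; exists w; rewrite !compl_adj // adjC.
Qed.

(** Outer induction on the length, inner induction on the chain of relations. The last relation
    either keeps the first letter or acts at the head; in the second case [lcm_cube] merges it with
    the chain before it. *)
Lemma lcm_letters m : lcm_at m.
Proof.
elim/ltn_ind: m => m IH i j X Y sX.
move eU: (j :: Y) => U e; elim: e j Y eU => [|V U' e IHe s] j Y.
  by case=> -> ->; exists X; rewrite compl_eq.
move=> eU; subst U'; have sV := peq_size e.
case: V s e IHe sV => [|k W] //= s e IHe [sW].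
have [Z [XZ WZ]] := IHe _ _ erefl.
have [sY] := pstep_size s.
have [[<- WY]|[V [eW eY]]] := pstep_consP s.
  by exists Z; split=> //; rewrite -(peq1 WY).
by apply: (lcm_cube IH sX _ _ XZ WZ (V := V)); rewrite -?sY -?sW ?eW ?eY.
Qed.

Lemma peq_lcm i j X Y : peq (i :: X) (j :: Y) ->
  exists Z, peq X (compl i j ++ Z) /\ peq Y (compl j i ++ Z).
Proof. exact: lcm_letters erefl. Qed.

Lemma peq_consI i X Y : peq (i :: X) (i :: Y) -> peq X Y.
Proof. exact: cancel_at (@lcm_letters _) erefl. Qed.

Lemma peq_catI w X Y : peq (w ++ X) (w ++ Y) -> peq X Y.
Proof. by elim: w => //= i w IH /peq_consI. Qed.

Lemma peq_Icat w X Y : peq (X ++ w) (Y ++ w) -> peq X Y.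
Proof.
by move=> /peq_rev; rewrite !rev_cat => /peq_catI/peq_rev; rewrite !revK.
Qed.

Lemma peq_rlcm i j X Y : peq (rcons X i) (rcons Y j) ->
  exists Z, peq X (Z ++ rev (compl i j)) /\ peq Y (Z ++ rev (compl j i)).
Proof.
move=> /peq_rev; rewrite !rev_rcons => /peq_lcm[Z [/peq_rev XZ /peq_rev YZ]].
by exists (rev Z); rewrite -!rev_cat -[X]revK -[Y]revK.
Qed.

(** * The full twist *)

Definition wpow (w : seq nat) (k : nat) : seq nat := flatten (nseq k w).

Lemma wpowS w k : wpow w k.+1 = w ++ wpow w k.
Proof. by []. Qed.

Lemma wpowD w k l : wpow w (k + l) = wpow w k ++ wpow w l.
Proof. by rewrite /wpow nseqD flatten_cat. Qed.

Lemma wpowSr w k : wpow w k.+1 = wpow w k ++ w.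
Proof. by rewrite -addn1 wpowD /wpow /= cats0. Qed.

Lemma far_cat i w v : all (far i) w -> peq (w ++ i :: v) (i :: w ++ v).
Proof.
elim: w => //= j w IH /andP[fij /IH ->].
by apply: peq_far; rewrite farC.
Qed.

Lemma far_catC u v : all (fun i => all (far i) v) u -> peq (u ++ v) (v ++ u).
Proof.
elim: u => [|i u IH] /=; first by rewrite cats0.
by move=> /andP[iv /IH ->]; rewrite far_cat.
Qed.

(** The letters after [i.+1] commute with [i], those before [i] commute with [i.+1], and one braid
    relation in between turns [i] into [i.+1]. So conjugation by delta_(M+1), spelled [iota 0 M],
    raises indices. *)
Lemma iota0_shift M i w : i.+1 < M ->
  peq (iota 0 M ++ i :: w) (i.+1 :: iota 0 M ++ w).
Proof.
move=> iM; have -> : M = i + (2 + (M - i.+2)) by lia.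
rewrite iotaD iotaD /= -!catA /= add0n addn2.
rewrite (@far_cat i (iota i.+2 _)); last first.
  by apply/allP => j; rewrite mem_iota /far; lia.
have a : adj i i.+1 by rewrite /adj eqxx.
rewrite (peq_adj _ a) far_cat //.
by apply/allP => j; rewrite mem_iota /far; lia.
Qed.

Lemma iota0_shift_word M w v : all (fun i => i.+1 < M) w ->
  peq (iota 0 M ++ w ++ v) (map succn w ++ iota 0 M ++ v).
Proof. by elim: w => //= i w IH /andP[iM /IH <-]; rewrite iota0_shift. Qed.

Lemma iota0_pow_shift M k v : k < M ->
  peq (wpow (iota 0 M) k ++ 0 :: v) (k :: wpow (iota 0 M) k ++ v).
Proof.
elim: k => //= k IH kM; rewrite !wpowS -!catA IH ?iota0_shift //; lia.
Qed.

(** In each new factor sigma_1 delta, the leading letter 0 crosses delta^k and comes out as the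
    letter [k], which extends [iota 0 k]. *)
Lemma wpow_root M k : k <= M ->
  peq (wpow (0 :: iota 0 M) k) (iota 0 k ++ wpow (iota 0 M) k).
Proof.
elim: k => // k IH kM.
rewrite wpowSr IH 1?ltnW // -catA iota0_pow_shift // wpowSr.
by rewrite -addn1 iotaD /= -catA.
Qed.

(** The index counts generators, not strands: this is the power M+1 of delta_(M+1), equal to
    Delta_(M+1)^2 by [half_twist_sq]. *)
Definition full_twist (M : nat) : seq nat := wpow (iota 0 M) M.+1.

Lemma full_twist_root M : peq (wpow (0 :: iota 0 M) M) (full_twist M).
Proof. exact: wpow_root. Qed.

(** The full twist is a power of delta and also of sigma_1 delta ([full_twist_root]), so it commutes
    with both and hence with sigma_1; conjugation by delta carries this to the other letters. *)
Lemma full_twist_commute M i : i < M ->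
  peq (full_twist M ++ [:: i]) (i :: full_twist M).
Proof.
set D := full_twist M.
have DC : peq (D ++ iota 0 M) (iota 0 M ++ D) by rewrite -wpowSr.
elim: i => [|i IH] iM.
  apply: (@peq_Icat (iota 0 M)); rewrite -catA /=.
  have := full_twist_root M; rewrite -/D => R.
  by rewrite DC -cat_cons -{1}R -wpowSr wpowS R.
apply: (@peq_Icat (iota 0 M)); rewrite -catA /=.
rewrite -{1}[iota 0 M]cats0 -iota0_shift // catA DC -catA IH 1?ltnW //.
by rewrite iota0_shift // DC.
Qed.

Lemma full_twist_commute_word M w v : all (gtn M) w ->
  peq (full_twist M ++ w ++ v) (w ++ full_twist M ++ v).
Proof.
elim: w => //= i w IH /andP[iM wM].
by rewrite -IH // -cat1s catA full_twist_commute.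
Qed.

Lemma full_twist_pow_commute M k w : all (gtn M) w ->
  peq (wpow (full_twist M) k ++ w) (w ++ wpow (full_twist M) k).
Proof.
move=> wM; elim: k => [|k IH]; first by rewrite cats0.
by rewrite wpowS -catA IH full_twist_commute_word.
Qed.

Lemma all_wpow (p : pred nat) w k : all p w -> all p (wpow w k).
Proof. by move=> pw; elim: k => // k IH; rewrite wpowS all_cat pw. Qed.

Lemma full_twist_all M : all (gtn M) (full_twist M).
Proof. by apply: all_wpow; apply/allP => i; rewrite mem_iota. Qed.

(** Write the full twist D as A i B. It commutes with A, so A i B A = D A = A D, and cancelling A
    leaves i B A = D. *)
Lemma full_twist_div M i : i < M ->
  exists2 Y, all (gtn M) Y & peq (i :: Y) (full_twist M).
Proof.
move=> iM; set D := full_twist M.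
have DAB : D = iota 0 i ++ i :: (iota i.+1 (M - i.+1) ++ wpow (iota 0 M) M).
  rewrite /D /full_twist wpowS {1}(_ : M = i + (1 + (M - i.+1))); last by lia.
  by rewrite !iotaD /= add0n addn1 -catA.
set B := (X in i :: X) in DAB.
have Am : all (gtn M) (iota 0 i).
  by apply/allP => j; rewrite mem_iota /=; lia.
have := full_twist_all M; rewrite -/D DAB all_cat /= => /and3P[_ _ BM].
exists (B ++ iota 0 i); first by rewrite all_cat BM.
apply: (@peq_catI (iota 0 i)).
have := @full_twist_commute_word M (iota 0 i) [::] Am.
by rewrite !cats0 -/D DAB -catA.
Qed.

(** * The Garside element Delta_m as a word, and its square *)

Fixpoint half_twist (m : nat) : seq nat :=
  if m is m'.+1 then iota 0 m' ++ half_twist m' else [::].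

Lemma half_twist_all m : all (fun i => i.+1 < m) (half_twist m).
Proof.
elim: m => //= m IH; rewrite all_cat; apply/andP; split.
  by apply/allP => i; rewrite mem_iota; lia.
by apply: sub_all IH => i; lia.
Qed.

Lemma half_twist_shift m :
  peq (map succn (half_twist m) ++ iota 0 m) (half_twist m.+1).
Proof.
rewrite /= -[half_twist m in X in peq _ X]cats0.
by rewrite iota0_shift_word ?half_twist_all // cats0.
Qed.

Definition half_twist_prefix (m k : nat) : seq nat :=
  flatten [seq iota 0 (m.-1 - j) | j <- iota 0 k].

Lemma half_twist_prefixE m : half_twist_prefix m m = half_twist m.
Proof.
elim: m => //= m <-; rewrite /half_twist_prefix /= subn0; congr (_ ++ _).
rewrite -[1]/(1 + 0) iotaDl -map_comp; congr flatten; apply: eq_map => j /=.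
by congr iota; lia.
Qed.

Lemma peq_map_addn j u v : peq u v -> peq (map (addn j) u) (map (addn j) v).
Proof.
elim=> // v' w _ IH s; rewrite IH; apply: peq1.
elim: s => [a b x f|a b x f|a x y _] /=; last exact: pstep_cons.
- by apply: pstep_far; move: f; rewrite /far; lia.
- by apply: pstep_adj; move: f; rewrite /adj; lia.
Qed.

(** Each new factor delta is cut after its first [M - k] letters. This beginning is far from the
    shifted half twist and joins the prefix; the rest enlarges the shifted half twist by
    [half_twist_shift]. At k = M+1 the shift is zero and both parts are Delta_(M+1). *)
Lemma wpow_half_twist M k : k <= M.+1 ->
  peq (wpow (iota 0 M) k)
      (half_twist_prefix M.+1 k ++ map (addn (M.+1 - k)) (half_twist k)).
Proof.
elim: k => // k IH kM; rewrite wpowSr IH 1?ltnW //.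
have -> : half_twist_prefix M.+1 k.+1 =
    half_twist_prefix M.+1 k ++ iota 0 (M - k).
  by rewrite /half_twist_prefix -[k.+1]addn1 iotaD map_cat flatten_cat /= cats0.
rewrite -!catA; apply: cat_peq => //.
have -> : iota 0 M = iota 0 (M - k) ++ map (addn (M - k)) (iota 0 k).
  by rewrite -iotaDl addn0 -[in RHS](add0n (M - k)) -iotaD subnK.
rewrite subSS subSn // catA (@far_catC (map _ _) (iota _ _)); last first.
  apply/allP => _ /mapP[i _ ->]; apply/allP => j; rewrite mem_iota /far; lia.
rewrite -catA; apply: cat_peq => //.
rewrite -(peq_map_addn _ (half_twist_shift k)) map_cat -map_comp.
apply: cat_peq => //.
rewrite (_ : map _ _ = map (addn (M - k) \o succn) (half_twist k)) //.
by apply: eq_map => i /=; rewrite addnS addSn.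
Qed.

Lemma half_twist_sq M : peq (half_twist M.+1 ++ half_twist M.+1) (full_twist M).
Proof.
rewrite /full_twist wpow_half_twist // half_twist_prefixE subnn.
by rewrite (_ : map _ _ = half_twist M.+1) // map_id_in.
Qed.

(** * The graph of left divisors *)

Section Confluence.
Variables (T : Type) (E U : relation T).

Definition reach : relation T := clos_refl_trans T (union T E U).

Definition reach_strict (x y : T) : Prop :=
  exists a b, [/\ reach x a, U a b & reach b y].

Definition either_reach (x y : T) : Prop := reach x y \/ reach y x.

Lemma reach_split x y : reach x y ->
  clos_refl_trans T E x y \/
  exists a b, [/\ clos_refl_trans T E x a, U a b & reach b y].
Proof.
move=> /clos_rt_rt1n_iff; elim=> {x y} [x|x y z xy /clos_rt_rt1n_iff yz IH].
  by left; exact: rt_refl.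
case: xy => xy; last by right; exists x, y; split=> //; exact: rt_refl.
case: IH => [IH|[a [b [ya ab bz]]]].
  by left; apply: rt_trans IH; exact: rt_step.
by right; exists a, b; split=> //; apply: rt_trans ya; exact: rt_step.
Qed.

Lemma conn_reach x y : clos_refl_trans T E x y -> reach x y.
Proof.
elim=> [a b ab|a|a b d _ ab _ bd]; [|exact: rt_refl|exact: rt_trans bd].
by apply: rt_step; left.
Qed.

(** Newman's argument by induction on [mu], with comparability of the end points in place of a
    common successor. Only strict paths are known to lower [mu], so the local condition compares
    one-way steps from two [E]-connected points. *)
Lemma reach_confluence (mu : T -> nat) :
  (forall x y, E x y -> E y x) ->
  (forall x y, reach_strict x y -> mu y < mu x) ->
  (forall x x' y y', clos_refl_trans T E x x' -> U x y -> U x' y' ->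
    either_reach y y') ->
  forall x y y', reach x y -> reach x y' -> either_reach y y'.
Proof.
move=> E_sym mu_lt local.
have conn_sym a b : clos_refl_trans T E a b -> clos_refl_trans T E b a.
  elim=> [u v /E_sym uv|u|u v w _ vu _ wv];
    [exact: rt_step|exact: rt_refl|exact: rt_trans vu].
move=> x; have [m] := ubnP (mu x); elim: m x => // m IH x xm y y'.
move=> xy xy'.
case: (reach_split xy) => [/conn_sym/conn_reach yx|[a [b [xa ab bY]]]].
  by left; exact: rt_trans xy'.
case: (reach_split xy') => [/conn_sym/conn_reach yx|[a' [b' [xa' ab' bY']]]].
  by right; exact: rt_trans xy.
have xb : reach_strict x b.
  by exists a, b; split=> //; [exact: conn_reach|exact: rt_refl].
have xb' : reach_strict x b'.
  by exists a', b'; split=> //; [exact: conn_reach|exact: rt_refl].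
have aa' : clos_refl_trans T E a a' by apply: rt_trans xa'; exact: conn_sym.
case: (local _ _ _ _ aa' ab ab') => [bb|bb].
- apply: (IH b) => //; first by have := mu_lt _ _ xb; lia.
  exact: rt_trans bY'.
- apply: (IH b') => //; first by have := mu_lt _ _ xb'; lia.
  exact: rt_trans bY.
Qed.

End Confluence.

Lemma reach_flip T (E U : relation T) : (forall x y, E x y -> E y x) ->
  forall x y, reach E (transp T U) x y -> reach E U y x.
Proof.
move=> E_sym x y; elim=> [a b [/E_sym ab|ab]|a|a b d _ ba _ db].
- by apply: rt_step; left.
- by apply: rt_step; right.
- exact: rt_refl.
- exact: rt_trans ba.
Qed.

Fixpoint words (s : seq nat) (n : nat) : seq (seq nat) :=
  if n is n'.+1 then [::] :: [seq i :: w | i <- s, w <- words s n']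
  else [:: [::]].

Lemma mem_words s n w : size w <= n -> {subset w <= s} -> w \in words s n.
Proof.
elim: n w => [|n IH] [|i w] //= wn ws; rewrite inE /=; apply/allpairsP.
exists (i, w); split=> //=; first by apply: ws; rewrite inE eqxx.
by apply: IH => // j jw; apply: ws; rewrite inE jw orbT.
Qed.

Lemma ltn_count (T : eqType) (a b : pred T) (s : seq T) z :
  subpred a b -> z \in s -> b z -> ~~ a z -> count a s < count b s.
Proof.
move=> ab zs bz az; elim: s zs => // w s IH; rewrite inE.
case/orP=> [/eqP<-|/IH lt] /=; first by rewrite bz (negbTE az) ltnS sub_count.
by rewrite -addnS leq_add //; case: (a w) (ab w) => // ->.
Qed.

(** * Paths between left divisors of a positive word *)

Section Divisors.
Variable c : seq nat.

Definition divisor (x : seq nat) : Prop := exists t, peq (x ++ t) c.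

Lemma divisor_peq x y : peq x y -> divisor x -> divisor y.
Proof. by move=> xy [t e]; exists t; rewrite -xy. Qed.

Lemma divisor_prefix x y : divisor (x ++ y) -> divisor x.
Proof. by move=> [t e]; exists (y ++ t); rewrite catA. Qed.

Lemma divisor_rcons x i : divisor (rcons x i) -> divisor x.
Proof. by rewrite -cats1; exact: divisor_prefix. Qed.

Lemma divisor_lcm x i j : divisor (rcons x i) -> divisor (rcons x j) ->
  divisor (x ++ i :: compl i j).
Proof.
move=> [t ti] [u uj].
have := peq_trans ti (peq_sym uj); rewrite -!cats1 -!catA => /peq_catI.
move=> /peq_lcm[Z [tZ _]].
by exists Z; rewrite -ti -cats1 -!catA /= -tZ.
Qed.

(* Level k of the divisor graph: letters below k may be used both ways, the
   letter k only forward. *)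
Definition edge (k : nat) (x y : seq nat) : Prop :=
  [/\ divisor x, divisor y &
   peq x y \/ exists2 j, j < k & peq y (rcons x j) \/ peq x (rcons y j)].

Definition up (k : nat) (x y : seq nat) : Prop :=
  [/\ divisor x, divisor y & peq y (rcons x k)].

Definition conn (k : nat) := clos_refl_trans _ (edge k).

Lemma edge_sym k x y : edge k x y -> edge k y x.
Proof.
move=> [Sx Sy xy]; split=> //.
case: xy => [/peq_sym e|[j jk [e|e]]]; first by left.
  by right; exists j => //; right.
by right; exists j => //; left.
Qed.

Lemma reach_peq k x y : divisor x -> peq x y -> reach (edge k) (up k) x y.
Proof.
move=> Sx xy; apply: rt_step; left; split=> //; last by left.
exact: divisor_peq Sx.
Qed.

Lemma reach_divisor k x y : reach (edge k) (up k) x y -> divisor x -> divisor y.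
Proof.
elim=> [a b [[]|[]]|a|a b d _ ab _ bd] //; by move=> /ab/bd.
Qed.

Lemma conn0 x y : conn 0 x y -> peq x y.
Proof.
by elim=> [a b [_ _ [//|[]//]]|a|a b d _ ab _ bd] //; rewrite ab.
Qed.

Lemma peq_rcons2_far x i j : far i j ->
  peq (rcons (rcons x i) j) (rcons (rcons x j) i).
Proof. by move=> f; rewrite -!cats1 -!catA /= (peq_far _ f). Qed.

Lemma peq_rcons3_adj x i j : adj i j ->
  peq (rcons (rcons (rcons x i) j) i) (rcons (rcons (rcons x j) i) j).
Proof. by move=> f; rewrite -!cats1 -!catA /= (peq_adj _ f). Qed.

Lemma farS j k : j < k -> far j k.+1.
Proof. by rewrite /far; lia. Qed.

Lemma adjS k : adj k k.+1.
Proof. by rewrite /adj eqxx. Qed.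

(** A letter below [k] commutes with [k.+1]. A forward step [k] becomes the path from x (k+1) to x
    (k+1) k, to x (k+1) k (k+1) = x k (k+1) k, and back along [k] to x k (k+1); least common
    multiples keep it among the divisors of [c]. *)
Lemma handle_up_step k x y : divisor (rcons x k.+1) ->
  union _ (edge k) (up k) x y ->
  divisor (rcons y k.+1) /\
  reach (edge k.+1) (up k.+1) (rcons x k.+1) (rcons y k.+1).
Proof.
move=> SxK [[Sx Sy [xy|[j jk [yx|xy]]]]|[Sx Sy yx]].
- have e : peq (rcons x k.+1) (rcons y k.+1) by rewrite xy.
  by split; [exact: divisor_peq SxK | exact: reach_peq].
- have f := farS jk.
  have Sxj : divisor (rcons x j) by apply: divisor_peq Sy.
  have SyK : divisor (rcons y k.+1).
    have := divisor_lcm Sxj SxK; rewrite compl_far // -cat_rcons cats1.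
    by apply: divisor_peq; rewrite yx.
  split=> //; apply: rt_step; left; split=> //; right; exists j; first by lia.
  by left; rewrite yx peq_rcons2_far.
- have f := farS jk.
  have e : peq (rcons x k.+1) (rcons (rcons y k.+1) j).
    by rewrite xy peq_rcons2_far.
  have SyK : divisor (rcons y k.+1).
    by apply: (@divisor_rcons _ j); apply: divisor_peq SxK.
  split=> //; apply: rt_step; left; split=> //; right; exists j; first by lia.
  by right.
- have f := adjS k.
  have Sxk : divisor (rcons x k) by apply: divisor_peq Sy.
  have S3 : divisor (rcons (rcons (rcons x k) k.+1) k).
    have := divisor_lcm Sxk SxK; rewrite compl_adj //.
    by rewrite -!cats1 -!catA.
  have S3' : divisor (rcons (rcons (rcons x k.+1) k) k.+1).
    by apply: divisor_peq S3; rewrite peq_rcons3_adj.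
  have SyK : divisor (rcons y k.+1).
    by apply: divisor_peq (divisor_rcons S3); rewrite yx.
  split=> //.
  apply: (rt_trans _ _ _ (rcons (rcons x k.+1) k)).
    apply: rt_step; left; split=> //; first exact: divisor_rcons S3'.
    by right; exists k => //; left.
  apply: (rt_trans _ _ _ (rcons (rcons (rcons x k.+1) k) k.+1)).
    by apply: rt_step; right; split=> //; exact: divisor_rcons S3'.
  apply: rt_step; left; split=> //; right; exists k => //; right.
  by rewrite yx (peq_rcons3_adj x f).
Qed.

Lemma handle_up k x y : reach (edge k) (up k) x y -> divisor (rcons x k.+1) ->
  divisor (rcons y k.+1) /\
  reach (edge k.+1) (up k.+1) (rcons x k.+1) (rcons y k.+1).
Proof.
elim=> [a b ab Sa|a Sa|a b d _ ab _ bd Sa].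
- exact: handle_up_step.
- by split=> //; exact: rt_refl.
- have [Sb ab'] := ab Sa; have [Sd bd'] := bd Sb.
  by split=> //; exact: rt_trans bd'.
Qed.

(** The mirror image of [handle_up_step]. For a forward step [k], right least common multiples give
    x = w k (k+1) and z = w (k+1) k, and the path runs from w k back to w, then to w (k+1) and to
    [z]. *)
Lemma handle_down_step k x y z : divisor z -> peq y (rcons z k.+1) ->
  union _ (edge k) (up k) x y ->
  exists z', [/\ peq x (rcons z' k.+1), divisor z' &
                 reach (edge k.+1) (up k.+1) z' z].
Proof.
move=> Sz yz [[Sx Sy [xy|[j jk [yx|xy]]]]|[Sx Sy yx]].
- by exists z; split=> //; [rewrite xy | exact: rt_refl].
- have f := farS jk; have f' : far k.+1 j by rewrite farC.
  have := yx; rewrite yz => /peq_sym/peq_rlcm[w].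
  rewrite compl_far // compl_far // /= !cats1 => -[xw zw].
  have Sw : divisor w by apply: (@divisor_rcons _ j); apply: divisor_peq Sz.
  exists w; split=> //; apply: rt_step; left; split=> //.
  by right; exists j; [lia|left].
- have f := farS jk.
  have e : peq x (rcons (rcons z j) k.+1) by rewrite xy yz (peq_rcons2_far z f).
  have Szj : divisor (rcons z j).
    by apply: (@divisor_rcons _ k.+1); apply: divisor_peq Sx.
  exists (rcons z j); split=> //; apply: rt_step; left; split=> //.
  by right; exists j; [lia|right].
- have f := adjS k; have f' : adj k.+1 k by rewrite adjC.
  have := yx; rewrite yz => /peq_sym/peq_rlcm[w].
  rewrite compl_adj // compl_adj // /rev /= -!cat_rcons !cats0 => -[xw zw].
  have Sz2 : divisor (rcons (rcons w k.+1) k) by apply: divisor_peq Sz.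
  have Sz1 := divisor_rcons Sz2; have Sw := divisor_rcons Sz1.
  have Swk : divisor (rcons w k).
    by apply: (@divisor_rcons _ k.+1); apply: divisor_peq Sx.
  exists (rcons w k); split=> //.
  apply: (rt_trans _ _ _ w).
    apply: rt_step; left; split=> //.
    by right; exists k => //; right.
  apply: (rt_trans _ _ _ (rcons w k.+1)); apply: rt_step.
    by right.
  by left; split=> //; right; exists k => //; left.
Qed.

Lemma handle_down k x y : reach (edge k) (up k) x y -> forall z, divisor z ->
  peq y (rcons z k.+1) -> exists z', [/\ peq x (rcons z' k.+1), divisor z' &
                 reach (edge k.+1) (up k.+1) z' z].
Proof.
elim=> [a b ab|a|a b d _ ab _ bd] z Sz bz.
- exact: handle_down_step ab.
- by exists z; split=> //; exact: rt_refl.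
- have [z1 [bz1 Sz1 z1z]] := bd _ Sz bz.
  have [z2 [az2 Sz2 z2z1]] := ab _ Sz1 bz1.
  by exists z2; split=> //; exact: rt_trans z1z.
Qed.

Lemma reach_strict_divisor k x y : reach_strict (edge k) (up k) x y ->
  divisor x /\ divisor y.
Proof.
move=> [a [b [xa [Sa Sb ab] bY]]]; split; last exact: reach_divisor bY Sb.
move: Sa; elim: xa => [u v [[]|[]]|u|u v w _ uv _ vw Sw] //.
exact/uv/vw.
Qed.

(** A finite list containing every word for a left divisor of [c], since such a word uses letters of
    [c] and is no longer than [c]. It may contain other words as well. *)
Definition divisors : seq (seq nat) := words c (size c).

Lemma mem_divisors x : divisor x -> x \in divisors.
Proof.
move=> [t e]; apply: mem_words.
  by rewrite -(peq_size e) size_cat leq_addr.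
have : all (mem c) (x ++ t) by apply: (peq_all (peq_sym e)); apply/allP.
by rewrite all_cat => /andP[/allP + _].
Qed.

(** Discharged by [divisor_acyclic]: a strict closed path would spell an i-positive word for the
    trivial braid. *)
Hypothesis acyclic : forall k x, ~ reach_strict (edge k) (up k) x x.

Lemma reach_strict_trans k x y z : reach_strict (edge k) (up k) x y ->
  reach_strict (edge k) (up k) y z -> reach_strict (edge k) (up k) x z.
Proof.
move=> [a [b [xa ab bY]]] [a' [b' [ya ab' bZ]]]; exists a, b; split=> //.
apply: rt_trans bY _; apply: rt_trans ya _; apply: rt_trans bZ.
by apply: rt_step; right.
Qed.

(** This count serves as [mu] in [reach_confluence]. It drops along a strict path because [y] is
    counted from [x] but, by acyclicity, not from [y]. *)
Lemma count_reach_lt k x y : reach_strict (edge k) (up k) x y ->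
  count (fun w => `[< reach_strict (edge k) (up k) y w >]) divisors <
  count (fun w => `[< reach_strict (edge k) (up k) x w >]) divisors.
Proof.
move=> xy; have [_ Sy] := reach_strict_divisor xy.
apply: (@ltn_count _ _ _ _ y); [|exact: mem_divisors|exact/asboolP|].
  by move=> w /asboolP yw; apply/asboolP; exact: reach_strict_trans yw.
by apply/asboolP; exact: acyclic.
Qed.

Lemma count_reach_gt k x y : reach_strict (edge k) (up k) x y ->
  count (fun w => `[< reach_strict (edge k) (up k) w x >]) divisors <
  count (fun w => `[< reach_strict (edge k) (up k) w y >]) divisors.
Proof.
move=> xy; have [Sx _] := reach_strict_divisor xy.
apply: (@ltn_count _ _ _ _ x); [|exact: mem_divisors|exact/asboolP|].
  by move=> w /asboolP wx; apply/asboolP; exact: reach_strict_trans wx xy.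
by apply/asboolP; exact: acyclic.
Qed.

(** At level 0 connected words are equal. At a higher level the hypothesis turns connectedness into
    a path one level down, and [handle_up] carries that path past the letter [k.+1]. *)
Lemma up_local k :
  (forall k', k = k'.+1 -> forall x y, conn k x y ->
    either_reach (edge k') (up k') x y) ->
  forall x x' y y', conn k x x' -> up k x y -> up k x' y' ->
  either_reach (edge k) (up k) y y'.
Proof.
case: k => [|k] cmp x x' y y' xx [Sx Sy yx] [Sx' Sy' yx'].
  by left; apply: reach_peq => //; rewrite yx yx' (conn0 xx).
have SxK : divisor (rcons x k.+1) by apply: divisor_peq Sy.
have SxK' : divisor (rcons x' k.+1) by apply: divisor_peq Sy'.
have [xx'|xx'] := cmp _ erefl _ _ xx; [left|right].
- have [_ r] := handle_up xx' SxK.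
  apply: rt_trans (reach_peq _ Sy yx) _; apply: rt_trans r _.
  by apply: reach_peq => //; exact: peq_sym.
- have [_ r] := handle_up xx' SxK'.
  apply: rt_trans (reach_peq _ Sy' yx') _; apply: rt_trans r _.
  by apply: reach_peq => //; exact: peq_sym.
Qed.

Lemma down_local k :
  (forall k', k = k'.+1 -> forall x y, conn k x y ->
    either_reach (edge k') (up k') x y) ->
  forall x x' y y', conn k y y' -> up k x y -> up k x' y' ->
  either_reach (edge k) (up k) x x'.
Proof.
case: k => [|k] cmp x x' y y' yy [Sx Sy yx] [Sx' Sy' yx'].
  left; apply: reach_peq => //; apply: (@peq_Icat [:: 0]).
  by rewrite !cats1 -yx -yx' (conn0 yy).
have [yy'|yy'] := cmp _ erefl _ _ yy; [left|right].
- have [z [yz Sz zx]] := handle_down yy' Sx' yx'.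
  apply: rt_trans zx; apply: reach_peq => //; apply: (@peq_Icat [:: k.+1]).
  by rewrite !cats1 -yx.
- have [z [yz Sz zx]] := handle_down yy' Sx yx.
  apply: rt_trans zx; apply: reach_peq => //; apply: (@peq_Icat [:: k.+1]).
  by rewrite !cats1 -yx'.
Qed.

Lemma up_confluence k :
  (forall k', k = k'.+1 -> forall x y, conn k x y ->
    either_reach (edge k') (up k') x y) ->
  forall x y y', reach (edge k) (up k) x y -> reach (edge k) (up k) x y' ->
  either_reach (edge k) (up k) y y'.
Proof.
move=> cmp; apply: (reach_confluence (@edge_sym k) (@count_reach_lt k)).
exact: up_local.
Qed.

Lemma down_confluence k :
  (forall k', k = k'.+1 -> forall x y, conn k x y ->
    either_reach (edge k') (up k') x y) ->
  forall x x' y, reach (edge k) (up k) x y -> reach (edge k) (up k) x' y ->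
  either_reach (edge k) (up k) x x'.
Proof.
move=> cmp x x' y; have flip := reach_flip (@edge_sym k) (U := up k).
have unflip a b : reach (edge k) (up k) a b ->
    reach (edge k) (transp _ (up k)) b a.
  by move=> ab; apply: (reach_flip (@edge_sym k)).
have sflip a b : reach_strict (edge k) (transp _ (up k)) a b ->
    reach_strict (edge k) (up k) b a.
  by move=> [u [v [/flip au uv /flip vb]]]; exists v, u.
move=> /unflip xy /unflip x'y.
suff: either_reach (edge k) (transp _ (up k)) x x'.
  by case=> /flip ?; [right | left].
apply: (reach_confluence (@edge_sym k) _ _ xy x'y).
  by move=> a b /sflip/count_reach_gt; exact.
move=> a a' b b' aa ab ab'.
have [/unflip ?|/unflip ?] := down_local cmp aa ab ab'; by [right|left].
Qed.

Lemma edgeS k x y : edge k.+1 x y ->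
  [\/ edge k x y, up k x y | up k y x].
Proof.
move=> [Sx Sy [xy|[j]]]; first by apply: Or31; split=> //; left.
rewrite ltnS leq_eqVlt => /orP[/eqP-> [e|e]|jk e].
- by apply: Or32.
- by apply: Or33.
- by apply: Or31; split=> //; right; exists j.
Qed.

(** The comparison is extended edge by edge. A new edge compatible with the direction of the path
    prolongs it; one pointing the other way is absorbed by upward or downward confluence. *)
Lemma conn_reach_total_step k x y :
  (forall k', k = k'.+1 -> forall x y, conn k x y ->
    either_reach (edge k') (up k') x y) ->
  clos_refl_trans_n1 _ (edge k.+1) x y -> either_reach (edge k) (up k) x y.
Proof.
move=> cmp; elim=> {y} [|y z yz _ [xy|yx]]; first by left; exact: rt_refl.
- case: (edgeS yz) => e.
  + by left; apply: rt_trans xy _; apply: rt_step; left.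
  + by left; apply: rt_trans xy _; apply: rt_step; right.
  + by apply: (down_confluence cmp xy); apply: rt_step; right.
- case: (edgeS yz) => e.
  + by right; apply: rt_trans yx; apply: rt_step; left; exact: edge_sym.
  + by apply: (up_confluence cmp yx); apply: rt_step; right.
  + by right; apply: rt_trans yx; apply: rt_step; right.
Qed.

Lemma conn_reach_total k x y :
  conn k.+1 x y -> either_reach (edge k) (up k) x y.
Proof.
elim: k x y => [|k IH] x y; rewrite /conn clos_rt_rtn1_iff => xy.
  have cmp k' : 0 = k'.+1 -> forall x y, conn 0 x y ->
    either_reach (edge k') (up k') x y by [].
  exact: conn_reach_total_step cmp xy.
have cmp k' : k.+1 = k'.+1 -> forall x y, conn k.+1 x y ->
  either_reach (edge k') (up k') x y by case=> <-.
exact: conn_reach_total_step cmp xy.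
Qed.

End Divisors.

(** * Comparison of braids *)

Section Evaluation.
Local Open Scope group_scope.
Variable n : nat.

Lemma braid_of_cat (v w : braid_word n) :
  braid_of (v ++ w) = braid_of v * braid_of w.
Proof. by rewrite -braid_of_mul. Qed.

Lemma braid_of_cons l (w : braid_word n) :
  braid_of (l :: w) = braid_of [:: l] * braid_of w.
Proof. by rewrite -braid_of_cat. Qed.

Lemma braid_of_neg (i : 'I_n.-1) : braid_of [:: (i, false)] = (sigma i)^-1.
Proof. by rewrite [RHS]braid_of_inv. Qed.

(* The junk value 1 breaks the braid relation at the boundary: ev respects peq
   only on words over the letters below n.-1. *)
Definition gen (i : nat) : braid n := if insub i is Some o then sigma o else 1.

Definition ev (w : seq nat) : braid n := \prod_(i <- w) gen i.

Lemma genE (i : 'I_n.-1) : gen i = sigma i.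
Proof. by rewrite /gen valK. Qed.

Lemma ev_nil : ev [::] = 1. Proof. exact: big_nil. Qed.
Lemma ev_cons i w : ev (i :: w) = gen i * ev w. Proof. exact: big_cons. Qed.
Lemma ev_cat u v : ev (u ++ v) = ev u * ev v. Proof. exact: big_cat. Qed.
Lemma ev_rcons w i : ev (rcons w i) = ev w * gen i.
Proof. by rewrite -cats1 ev_cat ev_cons ev_nil mulg1. Qed.

Lemma ev_wpow w k : ev (wpow w k) = ev w ^+ k.
Proof.
by elim: k => [|k IH]; [exact: ev_nil | rewrite wpowS ev_cat IH expgS].
Qed.

Lemma gen_far i j : i < n.-1 -> j < n.-1 -> far i j ->
  gen i * gen j = gen j * gen i.
Proof.
have lt_comm (a b : 'I_n.-1) :
    a.+1 < b -> sigma a * sigma b = sigma b * sigma a.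
  move=> ab; rewrite /sigma -!braid_of_cat; apply/braid_ofP.
  exact: braid_eqv_comm.
move=> iN jN; rewrite -[i]/(val (Ordinal iN)) -[j]/(val (Ordinal jN)) !genE.
by case/orP => [/lt_comm//|/lt_comm->].
Qed.

Lemma gen_adj i j : i < n.-1 -> j < n.-1 -> adj i j ->
  gen i * (gen j * gen i) = gen j * (gen i * gen j).
Proof.
have lt_braid (a b : 'I_n.-1) : a.+1 = b :> nat ->
    sigma a * (sigma b * sigma a) = sigma b * (sigma a * sigma b).
  move=> ab; rewrite /sigma -!braid_of_cat; apply/braid_ofP.
  exact: braid_eqv_braid.
move=> iN jN; rewrite -[i]/(val (Ordinal iN)) -[j]/(val (Ordinal jN)) !genE.
by case/orP => [/eqP/lt_braid//|/eqP/lt_braid->].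
Qed.

Lemma ev_pstep u v : pstep u v -> all (gtn n.-1) u -> ev u = ev v.
Proof.
elim=> {u v} [i j w f|i j w f|i u v _ IH] /=.
- move=> /and3P[iN jN _]; rewrite !ev_cons !mulgA; congr (_ * _).
  exact: gen_far.
- move=> /and4P[iN jN _ _]; rewrite !ev_cons !mulgA; congr (_ * _).
  by rewrite -!mulgA gen_adj.
- by move=> /andP[_ /IH e]; rewrite !ev_cons e.
Qed.

Lemma ev_peq u v : peq u v -> all (gtn n.-1) u -> ev u = ev v.
Proof.
elim=> // v' w uv' IH s uN; rewrite IH //; apply: ev_pstep s _.
exact: peq_all uv' uN.
Qed.

Lemma delta_ev k : k.-1 <= n.-1 -> delta n k = ev (iota 0 k.-1).
Proof.
move=> kn; rewrite /ev -{1}[k.-1]subn0 -/(index_iota 0 k.-1).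
rewrite (big_nat_widen _ _ _ _ _ kn) big_mkord; apply: eq_big => [i|i _].
  by case: k {kn} => //=; rewrite ltn0.
by rewrite genE.
Qed.

Lemma Delta_ev m : m < n -> Delta n m.+1 = ev (half_twist m.+1).
Proof.
rewrite /Delta /=; elim: m => [|m IH] mn.
  by rewrite big_nil ev_nil.
rewrite -[X in iota 2 X]addn1 iotaD rev_cat big_cat big_seq1 IH 1?ltnW //.
rewrite add2n delta_ev; last by rewrite /=; lia.
exact/esym/ev_cat.
Qed.

Lemma half_twist_gtn m : m <= n -> all (gtn n.-1) (half_twist m).
Proof. by move=> mn; apply: sub_all (half_twist_all m) => i /=; lia. Qed.

Lemma Delta_sqr m : m < n -> Delta n m.+1 ^+ 2 = ev (full_twist m).
Proof.
move=> mn; rewrite expg2 Delta_ev // -ev_cat; apply: ev_peq.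
  exact: half_twist_sq.
by rewrite all_cat half_twist_gtn.
Qed.

Lemma full_twist_gtn m : m < n -> all (gtn n.-1) (full_twist m).
Proof. by move=> mn; apply: sub_all (full_twist_all m) => i /=; lia. Qed.

Lemma ev_full_twistC m i : m < n -> i < m ->
  ev (full_twist m) * gen i = gen i * ev (full_twist m).
Proof.
move=> mn im; rewrite -ev_rcons -ev_cons; apply: ev_peq.
  by rewrite -cats1; exact: full_twist_commute.
by rewrite all_rcons full_twist_gtn //=; lia.
Qed.

(** Negative letters are cleared by central factors: the full twist z is sigma_i Y with Y positive
    ([full_twist_div]), so sigma_i^-1 z = Y. *)
Lemma braid_fraction (b : braid n) : 0 < n -> exists k v,
  all (gtn n.-1) v /\ ev (full_twist n.-1) ^+ k * b = ev v.
Proof.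
move=> n0; rewrite -(braid_of_repr b).
elim: (repr b) => [|[i e] w [k [v [vN kv]]]].
  by exists 0, [::]; rewrite ev_nil mul1g.
have nn : n.-1 < n by lia.
set z := ev _ in kv *.
have zi : commute z (sigma i) by rewrite /commute -genE ev_full_twistC.
rewrite braid_of_cons; case: e.
  exists k, (val i :: v); rewrite /= ltn_ord vN; split=> //.
  rewrite ev_cons genE -kv !mulgA; congr (_ * _).
  exact/esym/commuteX/commute_sym.
have [Y YN /ev_peq YD] := full_twist_div (ltn_ord i).
exists k.+1, (Y ++ v); rewrite all_cat YN vN; split=> //.
have : ev Y = (sigma i)^-1 * z.
  by rewrite -genE /z -YD ?ev_cons ?mulKg //= ltn_ord.
rewrite ev_cat -kv braid_of_neg => ->; rewrite !mulgA; congr (_ * _).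
rewrite -mulgA -expgS.
exact/commuteV/commute_sym/commuteX/commute_sym.
Qed.

End Evaluation.

(** * From paths of divisors to Dehornoy positive words *)

Section PropertyC.
Local Open Scope group_scope.
Variable n : nat.

Definition reach_word (k : nat) (w : braid_word n) : Prop :=
  forall j e, (j, e) \in w -> (j < k) || (j == k :> nat) && e.

Variable c : seq nat.
Hypothesis cN : all (gtn n.-1) c.

Lemma divisor_all x : divisor c x -> all (gtn n.-1) x.
Proof.
by move=> [t /peq_sym/peq_all/(_ cN)]; rewrite all_cat => /andP[].
Qed.

Lemma edge_word k x y : edge c k x y ->
  exists w, ev n y = ev n x * braid_of w /\ forall j e, (j, e) \in w -> j < k.
Proof.
move=> [/divisor_all xN /divisor_all yN [xy|[j jk [yx|xy]]]].
- by exists [::]; split=> //; rewrite mulg1 (ev_peq xy).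
- have := peq_all yx yN; rewrite all_rcons => /andP[jN _].
  exists [:: (Ordinal jN, true)]; split.
    by rewrite (ev_peq yx) // ev_rcons -[j]/(val (Ordinal jN)) genE.
  by move=> a e; rewrite inE => /eqP[-> _].
- have := peq_all xy xN; rewrite all_rcons => /andP[jN _].
  exists [:: (Ordinal jN, false)]; split.
    rewrite (ev_peq xy) // ev_rcons -[j]/(val (Ordinal jN)) genE.
    by rewrite braid_of_neg mulgK.
  by move=> a e; rewrite inE => /eqP[-> _].
Qed.

Lemma up_word k x y : up c k x y ->
  exists2 i : 'I_n.-1, i = k :> nat & ev n y = ev n x * sigma i.
Proof.
move=> [_ /divisor_all yN yx].
have := peq_all yx yN; rewrite all_rcons => /andP[kN _].
exists (Ordinal kN) => //.
by rewrite (ev_peq yx) // ev_rcons -[k]/(val (Ordinal kN)) genE.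
Qed.

Lemma reach_wordP k x y : reach (edge c k) (up c k) x y ->
  exists w, ev n y = ev n x * braid_of w /\ reach_word k w.
Proof.
elim=> [a b [/edge_word[w [-> wk]]|/up_word[i ik ->]]
       |a|a b d _ [v [-> vk]] _ [w [-> wk]]].
- by exists w; split=> // j e /wk ->.
- exists [:: (i, true)]; split=> // j e.
  by rewrite inE => /eqP[-> ->]; rewrite ik eqxx orbT.
- by exists [::]; rewrite mulg1.
- exists (v ++ w); rewrite braid_of_cat mulgA; split=> // j e.
  by rewrite mem_cat => /orP[/vk|/wk].
Qed.

Lemma reach_strict_positive k x y : reach_strict (edge c k) (up c k) x y ->
  exists2 i : 'I_n.-1, i = k :> nat & i_positive i ((ev n x)^-1 * ev n y).
Proof.
move=> [a [b [/reach_wordP[v [va vk]] /up_word[i ik ab]]]].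
move=> /reach_wordP[w [wy wk]].
exists i => //; exists (v ++ (i, true) :: w); split.
- rewrite wy ab va braid_of_cat [braid_of (_ :: _)]braid_of_cons.
  by rewrite -!mulgA mulKg.
- by rewrite mem_cat inE eqxx orbT.
- rewrite mem_cat inE; apply/negP => /or3P[/vk|/eqP//|/wk];
  by rewrite ik ltnn andbF.
- move=> j e; rewrite mem_cat inE ik => /or3P[/vk|/eqP[->]|/wk]; lia.
Qed.

(** Dehornoy's Property A, assumed in this section and proved in [i_positive_neq1]. *)
Hypothesis positive_neq1 : forall i : 'I_n.-1, ~ i_positive i (1 : braid n).

Lemma divisor_acyclic k x : ~ reach_strict (edge c k) (up c k) x x.
Proof.
move=> /reach_strict_positive[i _]; rewrite mulVg; exact: positive_neq1.
Qed.

(** Descent through the levels: a path with a one-way step spells a word that is positive in its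
    highest letter, and a path without one uses only lower letters, where the induction hypothesis
    applies. *)
Lemma conn_trichotomy k x y : conn c k x y ->
  [\/ ev n x = ev n y, dehornoy_cone n ((ev n x)^-1 * ev n y)
    | dehornoy_cone n ((ev n y)^-1 * ev n x)].
Proof.
elim: k => [|k IH] in x y *.
  move=> xy; apply: Or31.
  elim: xy => [a b [Sa _ [ab|[]//]]|//|a b d _ -> _ ->//].
  by apply: ev_peq ab _; exact: divisor_all.
move=> /(conn_reach_total divisor_acyclic)[] r.
- case: (reach_split r) => [/IH //|[a [b [xa ab bY]]]].
  have /reach_strict_positive[i _ ip] : reach_strict (edge c k) (up c k) x y.
    by exists a, b; split=> //; exact: conn_reach.
  by apply: Or32; exists i.
- case: (reach_split r) => [/IH[]|[a [b [xa ab bY]]]]; try by constructor.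
  have /reach_strict_positive[i _ ip] : reach_strict (edge c k) (up c k) y x.
    by exists a, b; split=> //; exact: conn_reach.
  by apply: Or33; exists i.
Qed.

Lemma conn_word k w : divisor c w -> all (gtn k) w -> conn c k [::] w.
Proof.
elim/last_ind: w => [|w i IH] Sw; first by move=> _; exact: rt_refl.
rewrite all_rcons => /andP[ik wk].
have Sw' := divisor_rcons Sw.
apply: rt_trans (IH Sw' wk) _; apply: rt_step; split=> //.
by right; exists i => //; left.
Qed.

End PropertyC.

Section Trichotomy.
Local Open Scope group_scope.

(** Clearing denominators gives b = D^-1 v with D a power of the full twist and v positive. Since D
    v = v D, both are left divisors of c = D v, and they are connected through the empty word. *)
Lemma dehornoy_trichotomy n (b : braid n) : 0 < n ->
  (forall i : 'I_n.-1, ~ i_positive i (1 : braid n)) ->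
  [\/ b = 1, dehornoy_cone n b | dehornoy_cone n b^-1].
Proof.
move=> n0 pos; have [k [v [vN kv]]] := braid_fraction b n0.
set D := wpow (full_twist n.-1) k.
have DN : all (gtn n.-1) D by apply: all_wpow; apply: full_twist_gtn; lia.
have evD : ev n D = ev n (full_twist n.-1) ^+ k by rewrite ev_wpow.
set c := D ++ v; have cN : all (gtn n.-1) c by rewrite all_cat DN.
have SD : divisor c D by exists v.
have Sv : divisor c v by exists D; rewrite -full_twist_pow_commute.
have Dv : conn c n.-1 D v.
  have sym x y : conn c n.-1 x y -> conn c n.-1 y x.
    elim=> [a a' /edge_sym aa|a|a a' d _ aa _ ad].
    - exact: rt_step.
    - exact: rt_refl.
    - exact: rt_trans aa.
  apply: rt_trans (conn_word Sv vN); apply: sym; exact: conn_word.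
have bE : b = (ev n D)^-1 * ev n v by rewrite evD -kv mulKg.
have bVE : b^-1 = (ev n v)^-1 * ev n D by rewrite bE invgM invgK.
rewrite bE -bE bVE bE; have [e|e|e] := conn_trichotomy cN pos Dv.
- by apply: Or31; rewrite e mulVg.
- by apply: Or32.
- by apply: Or33.
Qed.

End Trichotomy.

(** * Left orderings *)

Section IntegerPowers.
Local Open Scope group_scope.
Variables (G : groupType) (g : G).

Lemma expgzS k : expgz g (k + 1)%R = expgz g k * g.
Proof.
case: k => [m|[|m]].
- have -> : (Posz m + 1)%R = Posz m.+1 by lia.
  by rewrite /= expgSr.
- by rewrite /= mulVg.
- have -> : (Negz m.+1 + 1)%R = Negz m by lia.
  by rewrite /= [g ^+ m.+2]expgS invgM mulgVK.
Qed.

Lemma expgzD i j : expgz g (i + j)%R = expgz g i * expgz g j.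
Proof.
have nat_case m : expgz g (i + Posz m)%R = expgz g i * g ^+ m.
  elim: m => [|m IH]; first by rewrite GRing.addr0 mulg1.
  have -> : (i + Posz m.+1)%R = ((i + Posz m) + 1)%R by lia.
  by rewrite expgzS IH -mulgA -expgSr.
case: j => m //=.
have neg : forall m' i', expgz g i' = expgz g (i' - Posz m')%R * g ^+ m'.
  elim=> [|m' IH] i'; first by rewrite GRing.subr0 mulg1.
  have e : ((i' - Posz m'.+1) + 1)%R = (i' - Posz m')%R by lia.
  by rewrite expgS mulgA -expgzS e -IH.
by rewrite [in RHS](neg m.+1) mulgK; congr expgz; lia.
Qed.

Lemma expgzN i : expgz g (- i)%R = (expgz g i)^-1.
Proof.
apply: (mulgI (expgz g i)); rewrite mulgV -expgzD.
by have -> : (i + - i)%R = 0%R by lia.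
Qed.

End IntegerPowers.

Section ConeOrder.
Local Open Scope group_scope.
Variables (G : groupType) (P : set G).
Hypothesis LOP : LO G P.

Let lt := lt_cone P.
Let le := le_cone P.

Lemma coneM g h : P g -> P h -> P (g * h).
Proof. by case: LOP => + _ _; apply. Qed.

Lemma cone1 : ~ P 1.
Proof.
case: LOP => _ e _ P1; have : (~` [set 1])%classic (1 : G) by rewrite e; left.
by apply.
Qed.

Lemma cone_total g : [\/ g = 1, P g | P g^-1].
Proof.
case: LOP => _ e _; case: (pselect (g = 1)) => [->|g1]; first exact: Or31.
have : (~` [set 1])%classic g by [].
rewrite e => -[Pg|[h Ph <-]]; first exact: Or32.
by rewrite invgK; exact: Or33.
Qed.

Lemma cle_refl g : le g g. Proof. by left. Qed.

Lemma cltW g h : lt g h -> le g h. Proof. by right. Qed.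

Lemma clt_trans h g k : lt g h -> lt h k -> lt g k.
Proof. by move=> gh hk; have := coneM gh hk; rewrite mulgA mulgK. Qed.

Lemma cle_trans h g k : le g h -> le h k -> le g k.
Proof.
move=> [->//|gh] [<-|hk]; first by right.
by right; exact: clt_trans hk.
Qed.

Lemma clt_le_trans h g k : lt g h -> le h k -> lt g k.
Proof. by move=> gh [<-//|hk]; exact: clt_trans hk. Qed.

Lemma cle_lt_trans h g k : le g h -> lt h k -> lt g k.
Proof. by move=> [->//|gh] hk; exact: clt_trans hk. Qed.

Lemma clt_irr g : ~ lt g g.
Proof. by rewrite /lt /lt_cone mulVg; exact: cone1. Qed.

Lemma cle_total g h : le g h \/ lt h g.
Proof.
have [e|e|] := cone_total (g^-1 * h); last by rewrite invgM invgK; right.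
  by left; left; rewrite -[g]mulg1 -e mulVKg.
by left; right.
Qed.

Lemma clt_nle g h : lt g h -> ~ le h g.
Proof. by move=> gh hg; exact: (clt_irr (clt_le_trans gh hg)). Qed.

Lemma clt_mull k g h : lt g h -> lt (k * g) (k * h).
Proof. by rewrite /lt /lt_cone invgM -mulgA mulKg. Qed.

Lemma cle_mull k g h : le g h -> le (k * g) (k * h).
Proof. by move=> [->|gh]; [left|right; exact: clt_mull]. Qed.

Lemma clt_pow g k : lt 1 g -> lt 1 (g ^+ k.+1).
Proof.
move=> g1; elim: k => [|k IH]; first by rewrite expg1.
rewrite expgS; apply: clt_trans g1 _.
by rewrite -[X in lt X _]mulg1; exact: clt_mull.
Qed.

Lemma cle_pow g k : le 1 g -> le 1 (g ^+ k).
Proof.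
move=> [<-|g1]; first by rewrite expg1n; left.
by case: k => [|k]; [left | right; exact: clt_pow].
Qed.

Lemma cle_inv1 g : le 1 g -> le g^-1 1.
Proof. by move=> /(cle_mull g^-1); rewrite mulg1 mulVg. Qed.

Lemma cle_sign g : le 1 g \/ le 1 g^-1.
Proof.
by have [->|e|e] := cone_total g; [by left; left | left | right]; right;
  rewrite /lt_cone invg1 mul1g.
Qed.

Lemma cle_expgz z i j : lt 1 z -> le (expgz z i) (expgz z j) -> (i <= j)%R.
Proof.
move=> z1 zij; rewrite Order.TotalTheory.leNgt; apply/negP => ji.
have [k ek] : exists k : nat, i = (j + Posz k.+1)%R.
  by exists (`|i - j|.-1)%N; lia.
apply: clt_nle zij; rewrite ek expgzD -{1}[expgz z j]mulg1.
by apply: clt_mull; exact: clt_pow.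
Qed.

Definition bounded (w g : G) : Prop :=
  exists k : nat, le (w ^- k) g /\ le g (w ^+ k).

(** The order is invariant on the left only; as [w] commutes with [g], its powers can be moved to
    the other side of [g]. *)
Lemma boundedM w g h : commute w g ->
  bounded w g -> bounded w h -> bounded w (g * h).
Proof.
move=> wg [k [k1 k2]] [l [l1 l2]]; exists (k + l); split.
  apply: (cle_trans (h := g * w ^- l)); last exact: cle_mull.
  have -> : g * w ^- l = w ^- l * g.
    exact/commuteV/commuteX/commute_sym.
  by rewrite expgnDr invgM; exact: cle_mull.
apply: (cle_trans (h := g * w ^+ l)); first exact: cle_mull.
have -> : g * w ^+ l = w ^+ l * g by exact/commuteX/commute_sym.
by rewrite addnC expgnDr; exact: cle_mull.
Qed.

Lemma boundedV w g : commute w g -> bounded w g -> bounded w g^-1.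
Proof.
move=> wg [k [k1 k2]]; exists k; split.
  have := cle_mull (w ^- k * g^-1) k2; rewrite mulgVK.
  have -> : w ^- k * g^-1 = g^-1 * w ^- k.
    apply/commute_sym/commuteV/commuteX/commute_sym/commuteV/commute_sym.
    exact: commute_sym.
  by rewrite mulgVK.
have := cle_mull (w ^+ k * g^-1) k1; rewrite mulgVK.
have -> : w ^+ k * g^-1 = g^-1 * w ^+ k.
  by apply/commuteV/commute_sym/commuteX/commute_sym.
by rewrite mulgK.
Qed.

(** If 1 <= r then r <= r^(m+1), and if r <= 1 then r^(m+1) <= r; so [r] lies between 1 and its
    power, hence between w^-1 and w. *)
Lemma bounded_root w r m : le 1 w -> r ^+ m.+1 = w \/ r ^+ m.+1 = w^-1 ->
  bounded w r.
Proof.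
move=> w1 rw; have w1' := cle_inv1 w1; exists 1%N; rewrite expg1.
have [lo hi] : le w^-1 (r ^+ m.+1) /\ le (r ^+ m.+1) w.
  by case: rw => ->; split=> //; try exact: cle_refl; exact: cle_trans w1.
case: (cle_sign r) => r1; split.
- exact: cle_trans r1.
- apply: cle_trans hi; rewrite expgS -{1}[r]mulg1.
  by apply: cle_mull; exact: cle_pow.
- apply: cle_trans lo _; rewrite expgS -{3}[r]mulg1.
  apply: cle_mull; rewrite -[_ ^+ _]invgK; apply: cle_inv1.
  by rewrite -expVgn; exact: cle_pow.
- by apply: cle_trans w1; rewrite -[r]invgK; exact: cle_inv1.
Qed.

End ConeOrder.

Lemma int_transition (A : int -> Prop) (lo hi : int) :
  A lo -> (forall k, A k -> (k <= hi)%R) -> exists k, A k /\ ~ A (k + 1)%R.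
Proof.
move=> Alo Ahi; apply: contrapT => nA.
have AS m : A (lo + Posz m)%R.
  elim: m => [|m IH]; first by rewrite GRing.addr0.
  have -> : (lo + Posz m.+1)%R = (lo + Posz m + 1)%R by lia.
  by apply: contrapT => nS; apply: nA; exists (lo + Posz m)%R.
have := Ahi _ (AS `|hi - lo|.+1%N); lia.
Qed.

(** * Subgroups generated by the first Artin generators *)

Section BraidOrder.
Local Open Scope group_scope.
Variables (n : nat) (P : set (braid n)).
Hypothesis LOP : LO (braid n) P.

Let le := le_cone P.

(** Letters count from 0, so [low k] is the subgroup $B_{k+1}$; in particular [low n.-2] is
    $B_{n-1}$. *)
Definition low (k : nat) (b : braid n) : Prop :=
  exists w, b = braid_of w /\ forall j e, (j, e) \in w -> j < k.

Lemma low1 k : low k 1.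
Proof. by exists [::]. Qed.

Lemma lowM k b b' : low k b -> low k b' -> low k (b * b').
Proof.
move=> [v [-> vk]] [w [-> wk]]; exists (v ++ w); rewrite braid_of_cat.
by split=> // j e; rewrite mem_cat => /orP[/vk|/wk].
Qed.

Lemma lowV k b : low k b -> low k b^-1.
Proof.
move=> [w [-> wk]]; exists (word_inv w); split; first exact: braid_of_inv.
move=> j e; rewrite mem_rev => /mapP[[a d] /wk ak [-> _]]; exact: ak.
Qed.

Lemma low_ind k (Q : braid n -> Prop) : Q 1 ->
  (forall b b', low k b -> low k b' -> Q b -> Q b' -> Q (b * b')) ->
  (forall b, low k b -> Q b -> Q b^-1) ->
  (forall i : 'I_n.-1, i < k -> Q (sigma i)) ->
  forall b, low k b -> Q b.
Proof.
move=> Q1 QM QV Qs b [w [-> wk]]; elim: w wk => // [[i e] w] IH wk.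
have ik : i < k by apply: (wk i e); rewrite inE eqxx.
have wk' j d : (j, d) \in w -> j < k.
  by move=> jw; apply: (wk j d); rewrite inE jw orbT.
have li : low k (sigma i).
  by exists [:: (i, true)]; split=> // j d; rewrite inE => /eqP[-> _].
rewrite braid_of_cons; apply: QM.
- by exists [:: (i, e)]; split=> // j d; rewrite inE => /eqP[-> _].
- by exists w.
- case: e {wk}; first exact: Qs.
  by rewrite braid_of_neg; apply: QV => //; exact: Qs.
- exact: IH.
Qed.

Lemma low_ev k w : k <= n.-1 -> all (gtn k) w -> low k (ev n w).
Proof.
move=> kn; elim: w => [|i w IH] /=; first by rewrite ev_nil => _; exact: low1.
move=> /andP[ik /IH lw]; rewrite ev_cons; apply: lowM lw.
have iN : i < n.-1 by apply: leq_trans kn.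
exists [:: (Ordinal iN, true)]; split.
  by rewrite -[i]/(val (Ordinal iN)) genE.
by move=> j e; rewrite inE => /eqP[-> _].
Qed.

Lemma full_twist_low_commute m b : m < n -> low m b ->
  commute (ev n (full_twist m)) b.
Proof.
move=> mn; apply: low_ind => [|b1 b2 _ _|b1 _|i im].
- exact: commute1.
- exact: commuteM.
- exact: commuteV.
- by rewrite /commute -genE ev_full_twistC.
Qed.

Lemma delta_conj i M : i.+1 < M -> M <= n.-1 ->
  gen n i.+1 = ev n (iota 0 M) * gen n i * (ev n (iota 0 M))^-1.
Proof.
move=> iM Mn; have := @iota0_shift M i [::] iM; rewrite cats0 => /ev_peq e.
apply: (@mulIg _ (ev n (iota 0 M))).
rewrite mulgVK -ev_cons -ev_rcons -cats1 e // all_cat /= andbT.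
apply/andP; split; last by lia.
by apply/allP => j; rewrite mem_iota /=; lia.
Qed.

(* The subgroup generated by the letters below M is generated by delta and
   sigma_1 delta, both of which are roots of the full twist. *)
Lemma low_bounded M w : 0 < M -> M < n ->
  w = ev n (full_twist M) \/ w = (ev n (full_twist M))^-1 -> le 1 w ->
  forall b, low M b -> bounded P w b.
Proof.
move=> M0 Mn wE w1.
have MN : M <= n.-1 by lia.
have wC b : low M b -> commute w b.
  move=> /full_twist_low_commute -/(_ Mn) c; case: wE => -> //.
  exact/commute_sym/commuteV/commute_sym.
have iotaM : all (gtn M) (iota 0 M) by apply/allP => j; rewrite mem_iota.
set d := ev n (iota 0 M).
have ld : low M d by exact: low_ev.
have l0d : low M (ev n (0 :: iota 0 M)) by apply: low_ev => //=; rewrite M0.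
have root r k : 0 < k -> r ^+ k = ev n (full_twist M) -> bounded P w r.
  case: k => // k _ e; apply: (bounded_root LOP (m := k)) => //.
  by case: wE => ->; [left | right; rewrite invgK].
have bd : bounded P w d by apply: (root _ M.+1) => //; rewrite -ev_wpow.
have b0d : bounded P w (ev n (0 :: iota 0 M)).
  apply: (root _ M) => //; rewrite -ev_wpow; apply: ev_peq.
    exact: full_twist_root.
  apply: all_wpow => /=; apply/andP; split; first by lia.
  by apply/allP => j; rewrite mem_iota /=; lia.
have bgen i : i < M -> bounded P w (gen n i).
  elim: i => [|i IH] iM.
    have -> : gen n 0 = ev n (0 :: iota 0 M) * d^-1 by rewrite ev_cons mulgK.
    apply: (boundedM LOP) => //; first exact: wC.
    by apply: boundedV => //; exact: wC.
  have lgi : low M (gen n i).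
    rewrite -[gen n i]mulg1 -(ev_nil n) -ev_cons; apply: low_ev => //=.
    by rewrite andbT; lia.
  rewrite (delta_conj iM MN) -/d; apply: (boundedM LOP).
  - by apply: wC; exact: lowM.
  - apply: (boundedM LOP) => //; first exact: wC.
    by apply: IH; lia.
  - by apply: boundedV => //; exact: wC.
apply: low_ind => [|b1 b2 l1 l2 bb1 bb2|b1 l1 bb1|i im].
- by exists 0; split; left; rewrite ?invg1.
- by apply: (boundedM LOP) => //; exact: wC.
- by apply: boundedV => //; exact: wC.
- by rewrite -genE; exact: bgen.
Qed.

End BraidOrder.

(** * Translates of the cut and comparison of the two floors *)

Section Noncofinal.
Local Open Scope group_scope.
Variables (n : nat) (P : set (braid n)).
Hypothesis n3 : 3 <= n.
Hypothesis LOP : LO (braid n) P.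

Let lt := lt_cone P.
Let le := le_cone P.
Let z := Delta n n ^+ 2.
Hypothesis Pz : P z.
Hypothesis noncofinal : ~ cofinal P (Delta n n.-1 ^+ 2).

Lemma lt1z : lt 1 z.
Proof. by rewrite /lt /lt_cone invg1 mul1g. Qed.

Lemma full_twist_z : z = ev n (full_twist n.-1).
Proof. by have := @Delta_sqr n n.-1; rewrite (ltn_predK n3); apply. Qed.

Lemma low_top (b : braid n) : low n.-1 b.
Proof. by exists (repr b); rewrite braid_of_repr. Qed.

Lemma z_central (b : braid n) : commute z b.
Proof.
rewrite full_twist_z; apply: full_twist_low_commute (low_top b); lia.
Qed.

Lemma z_cofinal (b : braid n) : exists k : nat, le (z ^- k) b /\ le b (z ^+ k).
Proof.
apply: (low_bounded LOP (M := n.-1)); try lia.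
- by left; exact: full_twist_z.
- by right; exact: lt1z.
- exact: low_top.
Qed.

(** Non-cofinality provides a braid [h] lying strictly between w^-k and w^k for no k. Comparing [h]
    with the powers of z bounds all w^k, and then all of $B_{n-1}$ by [low_bounded]. *)
Lemma low_le_z : exists N : nat, forall b, low n.-2 b -> le b (z ^+ N).
Proof.
have := noncofinal; set w0 := Delta n n.-1 ^+ 2 => nc.
have w0E : w0 = ev n (full_twist n.-2).
  by rewrite /w0 (_ : n.-1 = n.-2.+1) ?Delta_sqr //; lia.
(* Passing to the inverse if necessary makes [w] at least 1; the exponents of both signs in
   [cofinal] allow this. *)
have [w [wE w1]] : exists w, (w = w0 \/ w = w0^-1) /\ le 1 w.
  by case: (cle_sign LOP w0) => ?; [exists w0 | exists w0^-1]; split; auto.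
have [h hP] : exists h : braid n,
    forall k : nat, le h (w ^- k) \/ le (w ^+ k) h.
  apply: contrapT => nh; apply: nc; apply/esym/seteqP; split=> // h _.
  apply: contrapT => nk; apply: nh; exists h => k.
  case: (cle_total LOP h (w ^- k)) => [?|lo]; first by left.
  case: (cle_total LOP (w ^+ k) h) => [?|hi]; first by right.
  case: nk; case: wE => wE; rewrite wE in lo hi.
    by exists (Posz k); rewrite expgzN.
  exists (- Posz k)%R; rewrite !expgzN invgK.
  by move: lo hi; rewrite !expVgn invgK.
have [N hN] : exists N : nat, forall k : nat, le (w ^+ k) (z ^+ N).
  have [N [lo hi]] := z_cofinal h; exists N => k.
  have wmono i j : (i <= j)%N -> le (w ^+ i) (w ^+ j).
    move=> ij; rewrite -(subnKC ij) expgnDr -{1}[w ^+ i]mulg1.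
    by apply: cle_mull; exact: (cle_pow LOP).
  case: (pselect (forall k, le (w ^+ k) h)) => [wh|/existsNP[k0 nk0]].
    exact: (cle_trans LOP) (wh k) hi.
  (* Here [h] is not above w^k0, so h <= w^-K and w^K h <= 1, while z^-N <= h gives 1 <= h z^N.
     Hence w^K <= w^K h z^N <= z^N. *)
  pose K := maxn k k0.
  have hK : le h (w ^- K).
    case: (hP K) => // /(cle_trans LOP (wmono _ _ (leq_maxr k k0))) /nk0 [].
  apply: (cle_trans LOP) (wmono _ _ (leq_maxl k k0)) _.
  apply: (cle_trans LOP (h := w ^+ K * h * z ^+ N)).
    rewrite -mulgA -{1}[w ^+ K]mulg1; apply: cle_mull.
    have := cle_mull (z ^+ N) lo; rewrite mulgV.
    by have /commute_sym/(commuteX N)/commute_sym -> := z_central h.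
  have /commute_sym/(commuteX N) -> := z_central (w ^+ K * h).
  rewrite -[X in le_cone _ _ X]mulg1; apply: cle_mull.
  by have := cle_mull (w ^+ K) hK; rewrite mulgV.
exists N => b lb.
have [|||k [_ bk]] := low_bounded LOP (M := n.-2) (w := w) _ _ _ w1 lb; try lia.
  by rewrite -w0E.
exact: (cle_trans LOP) (hN k).
Qed.

Definition cut (x : braid n) : Prop := exists2 b, low n.-2 b & le x b.

(* Inclusion of the translated cuts g C and h C. *)
Definition ple (g h : braid n) : Prop :=
  forall x, cut (g^-1 * x) -> cut (h^-1 * x).

Lemma cut_le x y : le x y -> cut y -> cut x.
Proof. by move=> xy [b lb yb]; exists b => //; exact: (cle_trans LOP) yb. Qed.

Lemma ple_trans h g k : ple g h -> ple h k -> ple g k.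
Proof. by move=> gh hk x /gh/hk. Qed.

Lemma ple_mull k g h : ple g h -> ple (k * g) (k * h).
Proof. by move=> gh x; rewrite !invgM -!mulgA; exact: gh. Qed.

(** Translated cuts are downward closed in a linear order: if [x] lies in g C but not in h C, then
    everything in h C is below [x]. *)
Lemma ple_total g h : ple g h \/ ple h g.
Proof.
case: (pselect (ple g h)) => [|/existsNP[x /not_implyP[gx hx]]]; first by left.
right=> y hy; case: (cle_total LOP x y) => [xy|yx].
  by case: hx; apply: cut_le hy; exact: cle_mull.
by apply: cut_le gx; apply: cle_mull; exact: cltW.
Qed.

Lemma ple_low b g : low n.-2 b -> ple (g * b) g.
Proof.
move=> lb x [b' lb' xb]; exists (b * b'); first exact: lowM.
by move: (cle_mull b xb); rewrite invgM -mulgA mulVKg.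
Qed.

Lemma ple_refl g : ple g g. Proof. by []. Qed.

Lemma lowM_ple b g : low n.-2 b -> ple g (g * b).
Proof.
move=> lb; rewrite -{1}[g](mulgK b); apply: ple_low; exact: lowV.
Qed.

Lemma ple_pow1 g k : ple g 1 -> ple (g ^+ k) 1.
Proof.
move=> g1; elim: k => // k IH; rewrite expgS; apply: ple_trans g1.
by rewrite -[X in ple _ X]mulg1; exact: ple_mull.
Qed.

(** An inclusion of z C in C would put z^(N+1) into C, which is bounded by z^N. *)
Lemma ple_z1 : ~ ple z 1.
Proof.
have [N hN] := low_le_z => /(@ple_pow1 _ N.+1) /(_ (z ^+ N.+1)).
rewrite mulVg invg1 mul1g => -[|b lb zb]; first by exists 1; [exact: low1|left].
apply: (clt_nle LOP) (cle_trans LOP zb (hN b lb)).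
rewrite -{1}[z ^+ N]mulg1 expgSr; apply: clt_mull; exact: lt1z.
Qed.

Lemma top_lt : n.-2 < n.-1. Proof. by lia. Qed.

Definition top : 'I_n.-1 := Ordinal top_lt.

Lemma low_letter (j : 'I_n.-1) e : j != top -> low n.-2 (braid_of [:: (j, e)]).
Proof.
move=> jt; exists [:: (j, e)]; split=> // i d; rewrite inE => /eqP[-> _].
by move: jt (ltn_ord j); rewrite -val_eqE /=; lia.
Qed.

(** If sigma_(n-1) C were contained in C, so would be delta_n C, as the other letters fix C, and
    then z C, as z = delta_n^n. This contradicts [ple_z1]. *)
Lemma ple_sigma_top : ple 1 (sigma top) /\ ~ ple (sigma top) 1.
Proof.
suff nst : ~ ple (sigma top) 1 by split=> //; case: (ple_total 1 (sigma top)).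
move=> st; apply: ple_z1; rewrite full_twist_z ev_wpow; apply: ple_pow1.
have : all (gtn n.-1) (iota 0 n.-1) by apply/allP => j; rewrite mem_iota.
elim: (iota _ _) => [|i w IH] /=; first by rewrite ev_nil => _; exact: ple_refl.
move=> /andP[iN /IH w1]; rewrite ev_cons; apply: (ple_trans (h := gen n i)).
  by rewrite -[X in ple _ X]mulg1; exact: ple_mull.
rewrite -[i]/(val (Ordinal iN)) genE.
case: (eqVneq (Ordinal iN) top) => [->//|jt].
by rewrite -[sigma _]mul1g; apply: ple_low; exact: low_letter.
Qed.

Lemma ple_word w : (top, false) \notin w -> ple 1 (braid_of w).
Proof.
elim: w => [|[j e] w IH]; first by move=> _; exact: ple_refl.
rewrite inE negb_or => /andP[je /IH w1]; rewrite braid_of_cons.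
apply: (ple_trans (h := braid_of [:: (j, e)])); last first.
  by rewrite -{1}[braid_of _]mulg1; exact: ple_mull.
case: (eqVneq j top) je => [->|jt _]; last first.
  by rewrite -[braid_of _]mul1g; apply: lowM_ple; exact: low_letter.
case: e => [_|]; last by rewrite eqxx.
by case: ple_sigma_top.
Qed.

(** Letters fixing C are stripped from the front up to the first sigma_(n-1), which enlarges C
    strictly; by [ple_word] the rest of the word cannot undo this. *)
Lemma ple_word_strict w : (top, false) \notin w -> (top, true) \in w ->
  ~ ple (braid_of w) 1.
Proof.
elim: w => // [[j e] w IH]; rewrite inE negb_or => /andP[je wt].
rewrite inE braid_of_cons; case: (eqVneq j top) je => [->|jt _].
  case: e => [_ _ gw|]; last by rewrite eqxx.
  case: ple_sigma_top => _; apply.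
  apply: ple_trans gw; rewrite -{1}[sigma top]mulg1.
  exact/ple_mull/ple_word.
rewrite xpair_eqE eq_sym (negbTE jt) => /(IH wt) nw gw; apply: nw.
have lj := low_letter e jt.
apply: (ple_trans (h := (braid_of [:: (j, e)])^-1)).
  by have := @ple_mull (braid_of [:: (j, e)])^-1 _ _ gw; rewrite mulKg mulg1.
by rewrite -[_^-1]mul1g; apply: ple_low; exact: lowV.
Qed.

Lemma i_positive_shift (i i' : 'I_n.-1) b :
  i.+1 = i' :> nat -> i_positive i b ->
  i_positive i' (ev n (iota 0 n.-1) * b * (ev n (iota 0 n.-1))^-1).
Proof.
move=> ii [w [-> wi wi' wj]].
pose sh (l : 'I_n.-1 * bool) := (insubd i' l.1.+1, l.2).
have shE l : l \in w -> (sh l).1 = l.1.+1 :> nat.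
  case: l => j e /wj ji; rewrite /= val_insubd ifT //.
  by have := ltn_ord i'; lia.
set d := ev n (iota 0 n.-1).
have shd l : l \in w -> braid_of [:: sh l] = d * braid_of [:: l] * d^-1.
  case: l => j e /shE jE.
  have jN : j.+1 < n.-1 by rewrite -jE; exact: ltn_ord.
  have := @delta_conj n j n.-1 jN (leqnn _); rewrite -jE !genE -/d => sE.
  case: e {jE} sE => sE; first exact: sE.
  by rewrite /sh !braid_of_neg sE !invgM invgK mulgA.
exists (map sh w); split.
- elim: w shd {wi wi' wj shE} => [|l w IH] shd; first by rewrite mulg1 mulgV.
  rewrite map_cons [braid_of (l :: w)]braid_of_cons.
  rewrite [braid_of (sh l :: _)]braid_of_cons.
  rewrite shd ?mem_head // -IH; last first.
    by move=> l' lw; apply: shd; rewrite inE lw orbT.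
  by rewrite -!mulgA mulKg.
- apply/mapP; exists (i, true) => //; congr pair.
  by apply: val_inj; rewrite /= (shE (i, true)).
- apply/negP => /mapP[[j e] jw [ji ee]]; move: wi'; rewrite ee.
  have := shE _ jw; rewrite /sh /= in ji *; rewrite -ji -ii => -[ij].
  by have -> : i = j; [exact: val_inj | rewrite jw].
- move=> _ e /mapP[l lw [-> _]].
  have /= -> := shE l lw; rewrite -ii ltnS.
  by case: l lw => j d' /wj.
Qed.

(** Conjugation by delta_n fixes 1 and raises the index of positivity, so the claim reduces to
    sigma_(n-1), where a positive word moves C. *)
Lemma i_positive_neq1 i : ~ i_positive i (1 : braid n).
Proof.
have [m] := ubnP (n.-2 - i); elim: m i => // m IH i im ip.
case: (eqVneq i top) => [it|it].
  move: ip; rewrite it => -[w [w1 wt wt' _]].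
  by apply: (ple_word_strict wt' wt); rewrite -w1.
have iN : i.+1 < n.-1 by move: it (ltn_ord i); rewrite -val_eqE /=; lia.
apply: (IH (Ordinal iN)); first by rewrite /=; lia.
have := @i_positive_shift i (Ordinal iN) _ erefl ip.
by rewrite mulg1 mulgV.
Qed.

(** An i-positive word never contains sigma_(n-1)^-1: for i = n-1 by positivity, for smaller i
    because no higher letter occurs. *)
Lemma dehornoy_ple b : dehornoy_cone n b -> ple 1 b.
Proof.
move=> [i [w [-> wi wi' wj]]]; apply: ple_word; apply/negP => wt.
have := wj _ _ wt; case: (eqVneq i top) => [it|].
  by rewrite it wt in wi'.
by have := ltn_ord i; rewrite -val_eqE /=; lia.
Qed.

Lemma trichotomy b : [\/ b = 1, dehornoy_cone n b | dehornoy_cone n b^-1].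
Proof. by apply: dehornoy_trichotomy; [lia | exact: i_positive_neq1]. Qed.

Lemma le_total_expgz b : exists N : int,
  le (expgz z (- N)%R) b /\ lt b (expgz z (N + 1)%R).
Proof.
have [k [k1 k2]] := z_cofinal b; exists (Posz k); rewrite expgzN; split=> //.
apply: (cle_lt_trans LOP) k2 _; rewrite expgzS -{1}[z ^+ k]mulg1.
by apply: clt_mull; exact: lt1z.
Qed.

Lemma floor_spec b : let j := braid_floor P b in
  le (expgz z j) b /\ lt b (expgz z (j + 1)%R).
Proof.
rewrite /braid_floor; apply: (@xgetPex _ 0%R
  [set k | le_cone P (expgz z k) b /\ lt_cone P b (expgz z (k + 1)%R)]).
have [N [lo hi]] := le_total_expgz b.
have [k [kb nkb]] : exists k, le (expgz z k) b /\ ~ le (expgz z (k + 1)%R) b.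
  apply: (@int_transition (fun k => le (expgz z k) b) (- N) (N + 1)) => // k.
  move=> kb; apply: (cle_expgz LOP lt1z); apply: (cle_trans LOP) kb _.
  exact: cltW.
exists k; split=> //.
by case: (cle_total LOP (expgz z (k + 1)%R) b).
Qed.

(** The element z^k lies in z^k C, hence in b C, so z^k <= b c <= b z^N = z^N b for some c in
    $B_{n-1}$. *)
Lemma ple_expgz_upper N k j b : (forall b, low n.-2 b -> le b (z ^+ N)) ->
  ple (expgz z k) b -> lt b (expgz z (j + 1)%R) -> (k <= j + 1 + Posz N)%R.
Proof.
move=> hN /(_ (expgz z k)); rewrite mulVg => -[|c lc kb hi].
  by exists 1; [exact: low1|left].
apply: (cle_expgz LOP lt1z).
apply: (cle_trans LOP (h := b * z ^+ N)).
  have := cle_mull b (cle_trans LOP kb (hN _ lc)); by rewrite mulVKg.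
have /commute_sym/(commuteX N) -> := z_central b.
rewrite GRing.addrC expgzD; apply: cle_mull; exact: cltW.
Qed.

Lemma ple_expgz_lower N k j b : (forall b, low n.-2 b -> le b (z ^+ N)) ->
  ple b (expgz z k) -> le (expgz z j) b -> (j <= k + Posz N)%R.
Proof.
move=> hN /(_ b); rewrite mulVg => -[|c lc kb lo].
  by exists 1; [exact: low1|left].
apply: (cle_expgz LOP lt1z); apply: (cle_trans LOP) lo _.
have := cle_mull (expgz z k) (cle_trans LOP kb (hN _ lc)).
by rewrite mulVKg expgzD.
Qed.

(** The floor exists because the two preceding bounds and trichotomy confine the change in the
    Dehornoy comparison of [b] with powers of z to a neighbourhood of its floor for [P]. *)
Lemma dehornoy_floor_spec b : let k := braid_floor (dehornoy_cone n) b in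
  ple (expgz z k) b /\ ple b (expgz z (k + 1)%R).
Proof.
set D := dehornoy_cone n.
have le_ple g h : le_cone D g h -> ple g h.
  move=> [->|/dehornoy_ple gh]; first exact: ple_refl.
  by have := @ple_mull g _ _ gh; rewrite mulg1 mulVKg.
have nle_lt g h : ~ le_cone D g h -> lt_cone D h g.
  move=> ngh; case: (trichotomy (h^-1 * g)) => [e| //|hg].
    by case: ngh; left; rewrite -[h]mulg1 -e mulVKg.
  by case: ngh; right; move: hg; rewrite invgM invgK.
suff [lo hi] : le_cone D (expgz z (braid_floor D b)) b
    /\ lt_cone D b (expgz z (braid_floor D b + 1)%R).
  by split; apply: le_ple => //; right.
rewrite {1 2}/braid_floor; apply: (@xgetPex _ 0%R
  [set k | le_cone D (expgz z k) b /\
           lt_cone D b (expgz z (k + 1)%R)]).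
have [N hN] := low_le_z; have [lo hi] := floor_spec b.
set j := braid_floor P b in lo hi.
have [k [kb nkb]] : exists k, le_cone D (expgz z k) b /\
    ~ le_cone D (expgz z (k + 1)%R) b.
  apply: (@int_transition (fun k => le_cone D (expgz z k) b)
    (j - Posz N - 1)%R (j + 1 + Posz N)%R) => [|k /le_ple kb].
    (* Failure at j - N - 1 would give j <= (j - N - 1) + N. *)
    apply: contrapT => /nle_lt bk.
    have := ple_expgz_lower hN (le_ple _ _ (or_intror bk)) lo; lia.
  exact: ple_expgz_upper hN kb hi.
by exists k; split=> //; exact: nle_lt.
Qed.

Lemma floor_dist : exists B : nat, forall b,
  (`|braid_floor P b - braid_floor (dehornoy_cone n) b| <= B)%N.
Proof.
(* With floors j for [P] and k for the Dehornoy cone, the bounds read k <= j + 1 + N and j <= (k +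
   1) + N. *)
have [N hN] := low_le_z; exists N.+1 => b.
have [lo hi] := floor_spec b; have [dlo dhi] := dehornoy_floor_spec b.
have := ple_expgz_upper hN dlo hi; have := ple_expgz_lower hN dhi lo; lia.
Qed.

End Noncofinal.

(** * Limits under bounded perturbation *)

Section Limit.
Import Order.TTheory GRing.Theory Num.Theory.
Local Open Scope ring_scope.
Local Open Scope classical_set_scope.

Lemma cvg_close (R : realType) (u v : nat -> int) (B : nat) (l : R) :
  (forall k, (`|u k - v k| <= B)%N) ->
  (fun k => (u k)%:~R / k%:R : R) @ \oo --> l ->
  (fun k => (v k)%:~R / k%:R : R) @ \oo --> l.
Proof.
move=> uv ul.
have d0 : (fun k => ((v k)%:~R - (u k)%:~R) / k%:R : R) @ \oo --> (0 : R).
  (* The shift skips the division by zero at k = 0 and turns the bound into B / (k + 1), a multiple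
     of [harmonic]. *)
  rewrite -cvg_shiftS; apply/norm_cvg0P.
  apply: (@squeeze_cvgr _ _ _ _ (fun=> 0) (fun k => B%:R * harmonic k)).
  - apply: nearW => k; rewrite normr_ge0 /= normrM normfV normr_nat /harmonic.
    rewrite ler_wpM2r ?invr_ge0 ?ler0n // -intrB -intr_norm.
    by rewrite -[B%:R]/((Posz B)%:~R) ler_int; have := uv k.+1; lia.
  - exact: cvg_cst.
  - rewrite -[X in _ --> X](mulr0 B%:R); apply: cvgM.
    + exact: cvg_cst.
    + exact: cvg_harmonic.
have -> : (fun k => (v k)%:~R / k%:R : R) =
    (fun k => (u k)%:~R / k%:R + ((v k)%:~R - (u k)%:~R) / k%:R).
  by apply/funext => k; rewrite -mulrDl addrC subrK.
by rewrite -[l]addr0; exact: cvgD.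
Qed.

(* Neither sequence needs to converge: the two have the same sets of limits. *)
Lemma limn_close (R : realType) (u v : nat -> int) (B : nat) :
  (forall k, (`|u k - v k| <= B)%N) ->
  limn (fun k => (u k)%:~R / k%:R : R) = limn (fun k => (v k)%:~R / k%:R : R).
Proof.
move=> uv; congr (get _); apply/funext => l; apply/propext; split.
  exact: cvg_close uv.
by apply: (@cvg_close _ _ _ B) => k; rewrite distnC.
Qed.

End Limit.

Theorem theorem1p1 (R : realType) (n : nat) (P : set (braid n)) :
  (3 <= n)%N ->
  LO (braid n) P ->
  P (Delta n n ^+ 2)%g ->
  ~ cofinal P (Delta n n.-1 ^+ 2)%g ->
  forall beta : braid n,
    translation_number R P beta = translation_number R (dehornoy_cone n) beta.
Proof.
move=> n3 LOP Pz nc beta; have [B hB] := floor_dist n3 LOP Pz nc.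
(* The bound [B] does not depend on the braid, so it holds at every power of [beta]. *)
exact: (@limn_close _ _ _ B).
Qed.
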